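(* Let $\alpha_{kl}\in\mathbb{C}$ ($k,l\ge 0$) satisfy $\alpha_{kl}=\alpha_{lk}$, let $\bar\varphi(a,b)=\sum_{k,l\ge 0}\alpha_{kl}[a^kb^lab]\in\widehat{\bar L}_3$, and let $f(\lambda,\mu)=\sum_{k,l\ge 0}\alpha_{kl}\lambda^k\mu^l\in\mathbb{C}[[\lambda,\mu]]$. Then $\bar\varphi$ satisfies the compressed hexagon equation if and only if $$f(\lambda,\mu)+e^{\mu}f(\mu,-\lambda-\mu)+e^{-\lambda}f(\lambda,-\lambda-\mu)=\frac{1}{\lambda+\mu}\left(\frac{e^{\mu}-1}{\mu}+\frac{e^{-\lambda}-1}{\lambda}\right)$$ in $\mathbb{C}[[\lambda,\mu]]$. Moreover, the compressed pentagon equation for $\bar\varphi$ follows from the symmetry $\alpha_{kl}=\alpha_{lk}$ alone.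
   Context: All Lie algebras are over $\mathbb{C}$. For elements $x_1,\dots,x_k$ of a Lie algebra put $[x_1x_2\ldots x_k]=[x_1,[x_2,[\ldots,x_k]\ldots]]$; powers denote repeated letters, so $[a^kb^lab]=\mathrm{ad}_a^k\,\mathrm{ad}_b^l\,[a,b]$. For $n\ge 2$ let $L_n$ be the Lie algebra generated by $t^{ij}=t^{ji}$, $1\le i\ne j\le n$, with relations $[t^{ij},t^{kl}]=0$ for pairwise distinct $i,j,k,l$ and $[t^{ij},t^{jk}]=[t^{jk},t^{ki}]=[t^{ki},t^{ij}]$ for pairwise distinct $i,j,k$; it is graded by $\deg t^{ij}=1$. Put $\bar L_n=L_n/\bigl[[L_n,L_n],[L_n,L_n]\bigr]$ and let $\widehat{\bar L}_n$ be its degree completion. In $L_3$ write $a=t^{12}$, $b=t^{23}$, $c=t^{13}$. For $x,y$ of positive degree in some $\widehat{\bar L}_n$, $\bar\varphi(x,y)=\sum\alpha_{kl}[x^ky^lxy]$. Compressed hexagon (in $\widehat{\bar L}_3$): $b+c=\log\bigl(e^{\bar\varphi(c,a)}e^{c}e^{-\bar\varphi(c,b)}e^{b}e^{\bar\varphi(a,b)}\bigr)$. Compressed pentagon (in $\widehat{\bar L}_4$): $\log\bigl(e^{\bar\varphi(t^{23},t^{34})}e^{\bar\varphi(t^{12}+t^{13},\,t^{24}+t^{34})}e^{\bar\varphi(t^{12},t^{23})}\bigr)=\log\bigl(e^{\bar\varphi(t^{12},\,t^{23}+t^{24})}e^{\bar\varphi(t^{13}+t^{23},\,t^{34})}\bigr)$.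 The logarithms of products of exponentials are computed by the Campbell–Baker–Hausdorff series. *)

(* Defs.v *)
From HB Require Import structures.
From mathcomp Require Import all_boot all_order all_algebra.
From mathcomp Require Import boolp classical_sets reals complex zify.

Set Implicit Arguments.
Unset Strict Implicit.
Unset Printing Implicit Defensive.

Import Order.TTheory GRing.Theory Num.Theory.
Local Open Scope classical_set_scope.
Local Open Scope ring_scope.
Local Open Scope quotient_scope.

HB.mixin Record isLieAlgebra (K : fieldType) L of GRing.Lmodule K L := {
  lie : L -> L -> L;
  lieDl : forall x y z, lie (x + y) z = lie x z + lie y z;
  lieDr : forall x y z, lie z (x + y) = lie z x + lie z y;
  lieZl : forall a x y, lie (a *: x) y = a *: lie x y;
  lieZr : forall a x y, lie y (a *: x) = a *: lie y x;
  liexx : forall x, lie x x = 0;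
  lie_jacobi : forall x y z,
    lie x (lie y z) + lie y (lie z x) + lie z (lie x y) = 0
}.

#[short(type="lieAlgType")]
HB.structure Definition LieAlgebra (K : fieldType) :=
  {L of GRing.Lmodule K L & isLieAlgebra K L}.

Section LieTheory.
Variables (K : fieldType) (L : lieAlgType K).
Implicit Types (x y z : L) (A B G : set L).

Lemma lie0x x : lie 0 x = 0.
Proof. by have := lieZl 0 0 x; rewrite !scale0r. Qed.

Lemma liex0 x : lie x 0 = 0.
Proof. by have := lieZr 0 0 x; rewrite !scale0r. Qed.

Lemma lieNx x y : lie (- x) y = - lie x y.
Proof. by rewrite -scaleN1r lieZl scaleN1r. Qed.

Lemma liexN x y : lie x (- y) = - lie x y.
Proof. by rewrite -scaleN1r lieZr scaleN1r. Qed.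

Lemma lieBl x y z : lie (x - y) z = lie x z - lie y z.
Proof. by rewrite lieDl lieNx. Qed.

Lemma lieBr x y z : lie z (x - y) = lie z x - lie z y.
Proof. by rewrite lieDr liexN. Qed.

Lemma lie_anti x y : lie x y = - lie y x.
Proof.
apply/eqP; rewrite -addr_eq0; apply/eqP.
by have := liexx (x + y); rewrite lieDl !lieDr !liexx addr0 add0r.
Qed.

Lemma lie_suml (I : Type) (r : seq I) (P : pred I) (F : I -> L) y :
  lie (\sum_(i <- r | P i) F i) y = \sum_(i <- r | P i) lie (F i) y.
Proof.
exact: (big_morph (fun x => lie x y) (fun a b => lieDl a b y) (lie0x y)).
Qed.

Lemma lie_sumr (I : Type) (r : seq I) (P : pred I) (F : I -> L) y :
  lie y (\sum_(i <- r | P i) F i) = \sum_(i <- r | P i) lie y (F i).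
Proof.
exact: (big_morph (fun x => lie y x) (fun a b => lieDr a b y) (liex0 y)).
Qed.

(** [lbr [:: x1; ...; xk]] is [[x1 x2 ... xk] = [x1, [x2, [..., xk]...]]];
    the bracket of a one-letter word is that letter. *)
Fixpoint lbr (s : seq L) : L :=
  if s is x :: s' then (if s' is [::] then x else lie x (lbr s')) else 0.

(** [[A, B]]: the linear span of the brackets of an element of [A] with an
    element of [B]. *)
Inductive lie_span A B : set L :=
| lie_span0 : lie_span A B 0
| lie_spanD a x y z : A x -> B y -> lie_span A B z ->
    lie_span A B (a *: lie x y + z).

Definition derived1 : set L := lie_span setT setT.
Definition derived2 : set L := lie_span derived1 derived1.

(** The span of the brackets of [d] elements of [G], in any arrangement of the
    brackets. *)
Inductive homog G : nat -> set L :=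
| homog_gen x : G x -> homog G 1 x
| homog0 d : homog G d 0
| homogD d x y : homog G d x -> homog G d y -> homog G d (x + y)
| homogZ d a x : homog G d x -> homog G d (a *: x)
| homog_lie d e x y : homog G d x -> homog G e y -> homog G (d + e) (lie x y).

Lemma homogN G d x : homog G d x -> homog G d (- x).
Proof. by rewrite -scaleN1r; exact: homogZ. Qed.

Lemma homog_sum G d (I : Type) (r : seq I) (P : pred I) (F : I -> L) :
  (forall i, P i -> homog G d (F i)) -> homog G d (\sum_(i <- r | P i) F i).
Proof.
by move=> h; apply: big_ind => //; [exact: homog0 | exact: homogD].
Qed.

Lemma homog_deg0 G x : homog G 0 x -> x = 0.
Proof.
move: {-2}0%N (erefl 0%N) => d; move=> /[swap]; elim=> //.
- by move=> {}d y z _ IHy _ IHz d0; rewrite IHy // IHz // addr0.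
- by move=> {}d a y _ IHy d0; rewrite IHy // scaler0.
- move=> {}d e y z _ IHy _ _ /eqP; rewrite addn_eq0 => /andP[/eqP d0 _].
  by rewrite IHy // lie0x.
Qed.

Record is_ideal (I : set L) : Prop := IsIdeal {
  ideal0 : I 0;
  idealD : forall x y, I x -> I y -> I (x + y);
  idealZ : forall a x, I x -> I (a *: x);
  ideal_lie : forall x y, I y -> I (lie x y)
}.

Lemma lie_span_ideal A B :
  (forall z x, A x -> A (lie z x)) -> (forall z x, B x -> B (lie z x)) ->
  is_ideal (lie_span A B).
Proof.
move=> hA hB; split; first exact: lie_span0.
- move=> x y; elim=> [|a u v w Au Bv _ IH] hy; first by rewrite add0r.
  by rewrite -addrA; apply: lie_spanD => //; exact: IH.
- move=> a x; elim=> [|b u v w Au Bv _ IH].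
    by rewrite scaler0; exact: lie_span0.
  by rewrite scalerDr scalerA; exact: lie_spanD.
- move=> x y; elim=> [|a u v w Au Bv _ IH].
    by rewrite liex0; exact: lie_span0.
  rewrite lieDr lieZr.
  have -> : lie x (lie u v) = lie (lie x u) v + lie u (lie x v).
    rewrite [lie (lie _ _) _]lie_anti -liexN.
    have /eqP := lie_jacobi x u v; rewrite -addrA addr_eq0 => /eqP ->.
    rewrite opprD addrC [lie v x]lie_anti !liexN opprK //.
  by rewrite scalerDr -addrA; apply: lie_spanD => //;
    [exact: hA | apply: lie_spanD => //; exact: hB].
Qed.

Lemma derived2_ideal : is_ideal derived2.
Proof.
have h z x : derived1 x -> derived1 (lie z x).
  by case: (@lie_span_ideal setT setT) => // ? ? ? h; exact: h.
exact: lie_span_ideal.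
Qed.

End LieTheory.

Inductive lie_term (K X : Type) : Type :=
| LGen of X
| LZero
| LAdd of lie_term K X & lie_term K X
| LScale of K & lie_term K X
| LBr of lie_term K X & lie_term K X.
Arguments LGen {K X}.
Arguments LZero {K X}.

HB.instance Definition _ K X := gen_eqMixin (lie_term K X).
HB.instance Definition _ K X := gen_choiceMixin (lie_term K X).

Definition LSub (K : fieldType) X (s t : lie_term K X) :=
  LAdd s (LScale (-1) t).

Section Presentation.
Variables (K : fieldType) (X : Type) (rel : set (lie_term K X)).
Notation term := (lie_term K X).

(** Equality of terms in the Lie algebra generated by [X] with relators [rel]:
    the least congruence containing the Lie algebra axioms and [r = 0] for
    [rel r]. *)
Inductive lie_eq : term -> term -> Prop :=
| le_refl t : lie_eq t t
| le_sym s t : lie_eq s t -> lie_eq t s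
| le_trans s t u : lie_eq s t -> lie_eq t u -> lie_eq s u
| le_add s s' t t' : lie_eq s s' -> lie_eq t t' -> lie_eq (LAdd s t) (LAdd s' t')
| le_scale a t t' : lie_eq t t' -> lie_eq (LScale a t) (LScale a t')
| le_br s s' t t' : lie_eq s s' -> lie_eq t t' -> lie_eq (LBr s t) (LBr s' t')
| le_addA s t u : lie_eq (LAdd s (LAdd t u)) (LAdd (LAdd s t) u)
| le_addC s t : lie_eq (LAdd s t) (LAdd t s)
| le_add0 t : lie_eq (LAdd LZero t) t
| le_addN t : lie_eq (LAdd (LScale (-1) t) t) LZero
| le_scaleA a b t : lie_eq (LScale a (LScale b t)) (LScale (a * b) t)
| le_scale1 t : lie_eq (LScale 1 t) t
| le_scaleDr a s t :
    lie_eq (LScale a (LAdd s t)) (LAdd (LScale a s) (LScale a t))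
| le_scaleDl a b t :
    lie_eq (LScale (a + b) t) (LAdd (LScale a t) (LScale b t))
| le_brDl s t u : lie_eq (LBr (LAdd s t) u) (LAdd (LBr s u) (LBr t u))
| le_brDr s t u : lie_eq (LBr u (LAdd s t)) (LAdd (LBr u s) (LBr u t))
| le_brZl a s t : lie_eq (LBr (LScale a s) t) (LScale a (LBr s t))
| le_brZr a s t : lie_eq (LBr t (LScale a s)) (LScale a (LBr t s))
| le_brxx t : lie_eq (LBr t t) LZero
| le_jacobi s t u :
    lie_eq (LAdd (LAdd (LBr s (LBr t u)) (LBr t (LBr u s))) (LBr u (LBr s t)))
           LZero
| le_rel r : rel r -> lie_eq r LZero.

Definition lie_eqb (s t : term) : bool := `[< lie_eq s t >].

Lemma lie_eqb_refl : reflexive lie_eqb.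
Proof. by move=> t; apply/asboolP; exact: le_refl. Qed.
Lemma lie_eqb_sym : symmetric lie_eqb.
Proof. by move=> s t; apply/asboolP/asboolP; exact: le_sym. Qed.
Lemma lie_eqb_trans : transitive lie_eqb.
Proof. by move=> t s u /asboolP h /asboolP h'; apply/asboolP; exact: le_trans h'. Qed.

Canonical lie_eq_equiv := EquivRel lie_eqb lie_eqb_refl lie_eqb_sym lie_eqb_trans.

Definition presented := {eq_quot lie_eq_equiv}.
HB.instance Definition _ := Choice.on presented.
HB.instance Definition _ := EqQuotient.on presented.

Lemma presentedP (s t : term) :
  \pi_presented s = \pi_presented t <-> lie_eq s t.
Proof.
split=> [/eqmodP/asboolP //|h]; by apply/eqmodP/asboolP.
Qed.

Lemma pr_reprK x : \pi_presented (repr x) = x. Proof. exact: reprK. Qed.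
Lemma pr_reprE t : lie_eq (repr (\pi_presented t)) t. Proof. by apply/presentedP; exact: pr_reprK. Qed.

Definition pr_add (x y : presented) : presented := \pi_presented (LAdd (repr x) (repr y)).
Definition pr_scale a (x : presented) : presented := \pi_presented (LScale a (repr x)).
Definition pr_lie (x y : presented) : presented := \pi_presented (LBr (repr x) (repr y)).

Lemma pr_addE s t : pr_add (\pi_presented s) (\pi_presented t) = \pi_presented (LAdd s t).
Proof. by apply/presentedP; apply: le_add; exact: pr_reprE. Qed.
Lemma pr_scaleE a t : pr_scale a (\pi_presented t) = \pi_presented (LScale a t).
Proof. by apply/presentedP; apply: le_scale; exact: pr_reprE. Qed.
Lemma pr_lieE s t : pr_lie (\pi_presented s) (\pi_presented t) = \pi_presented (LBr s t).
Proof. by apply/presentedP; apply: le_br; exact: pr_reprE. Qed.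

Lemma pr_ind (P : presented -> Prop) : (forall t, P (\pi_presented t)) -> forall x, P x.
Proof. by move=> h x; rewrite -(pr_reprK x). Qed.

Lemma pr_addA : associative pr_add.
Proof.
do 3![elim/pr_ind => ?]; rewrite !pr_addE; apply/presentedP; exact: le_addA.
Qed.
Lemma pr_addC : commutative pr_add.
Proof. do 2![elim/pr_ind => ?]; rewrite !pr_addE; apply/presentedP; exact: le_addC. Qed.
Lemma pr_add0 : left_id (\pi_presented LZero) pr_add.
Proof. elim/pr_ind => ?; rewrite !pr_addE; apply/presentedP; exact: le_add0. Qed.
Lemma pr_addN : left_inverse (\pi_presented LZero) (pr_scale (-1)) pr_add.
Proof. elim/pr_ind => ?; rewrite pr_scaleE pr_addE; apply/presentedP; exact: le_addN. Qed.
HB.instance Definition _ :=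
  GRing.isZmodule.Build presented pr_addA pr_addC pr_add0 pr_addN.

Lemma pr_scaleA a b x : pr_scale a (pr_scale b x) = pr_scale (a * b) x.
Proof. elim/pr_ind: x => ?; rewrite !pr_scaleE; apply/presentedP; exact: le_scaleA. Qed.
Lemma pr_scale1 : left_id 1 pr_scale.
Proof. elim/pr_ind => ?; rewrite !pr_scaleE; apply/presentedP; exact: le_scale1. Qed.
Lemma pr_scaleDr : right_distributive pr_scale +%R.
Proof.
move=> a; do 2![elim/pr_ind => ?]; rewrite /GRing.add /= !(pr_scaleE, pr_addE).
apply/presentedP; exact: le_scaleDr.
Qed.
Lemma pr_scaleDl x : {morph pr_scale^~ x : a b / a + b}.
Proof.
elim/pr_ind: x => ? a b; rewrite [RHS]/GRing.add /= !(pr_scaleE, pr_addE).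
apply/presentedP; exact: le_scaleDl.
Qed.
HB.instance Definition _ := GRing.Zmodule_isLmodule.Build K presented
  pr_scaleA pr_scale1 pr_scaleDr pr_scaleDl.

Lemma pr_paddE (s t : term) : \pi_presented s + \pi_presented t = \pi_presented (LAdd s t). Proof. exact: pr_addE. Qed.
Lemma pr_pscaleE a (t : term) : a *: \pi_presented t = \pi_presented (LScale a t). Proof. exact: pr_scaleE. Qed.

Lemma pr_lieDl x y z : pr_lie (x + y) z = pr_lie x z + pr_lie y z.
Proof.
elim/pr_ind: x => s; elim/pr_ind: y => t; elim/pr_ind: z => u.
rewrite !(pr_paddE, pr_lieE); apply/presentedP; exact: le_brDl.
Qed.
Lemma pr_lieDr x y z : pr_lie z (x + y) = pr_lie z x + pr_lie z y.
Proof.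
elim/pr_ind: x => s; elim/pr_ind: y => t; elim/pr_ind: z => u.
rewrite !(pr_paddE, pr_lieE); apply/presentedP; exact: le_brDr.
Qed.
Lemma pr_lieZl a x y : pr_lie (a *: x) y = a *: pr_lie x y.
Proof.
elim/pr_ind: x => s; elim/pr_ind: y => t.
rewrite !(pr_pscaleE, pr_lieE); apply/presentedP; exact: le_brZl.
Qed.
Lemma pr_lieZr a x y : pr_lie y (a *: x) = a *: pr_lie y x.
Proof.
elim/pr_ind: x => s; elim/pr_ind: y => t.
rewrite !(pr_pscaleE, pr_lieE); apply/presentedP; exact: le_brZr.
Qed.
Lemma pr_liexx x : pr_lie x x = 0.
Proof. elim/pr_ind: x => s; rewrite pr_lieE; apply/presentedP; exact: le_brxx. Qed.
Lemma pr_jacobi x y z :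
  pr_lie x (pr_lie y z) + pr_lie y (pr_lie z x) + pr_lie z (pr_lie x y) = 0.
Proof.
elim/pr_ind: x => s; elim/pr_ind: y => t; elim/pr_ind: z => u.
rewrite !(pr_lieE, pr_paddE); apply/presentedP; exact: le_jacobi.
Qed.
HB.instance Definition _ := isLieAlgebra.Build K presented
  pr_lieDl pr_lieDr pr_lieZl pr_lieZr pr_liexx pr_jacobi.

Lemma pi_add s t : \pi_presented (LAdd s t) = \pi_presented s + \pi_presented t.
Proof. exact: esym (pr_paddE s t). Qed.
Lemma pi_scale a t : \pi_presented (LScale a t) = a *: \pi_presented t.
Proof. exact: esym (pr_pscaleE a t). Qed.
Lemma pi_lie s t : \pi_presented (LBr s t) = lie (\pi_presented s) (\pi_presented t).
Proof. exact: esym (pr_lieE s t). Qed.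
Lemma pi_zero : \pi_presented LZero = 0.
Proof. by []. Qed.

End Presentation.

Section Quotient.
Variables (K : fieldType) (L : lieAlgType K) (I : set L) (hI : is_ideal I).

Definition ideal_eqb (x y : L) : bool := `[< I (x - y) >].

Lemma ideal_eqb_refl : reflexive ideal_eqb.
Proof. by move=> x; apply/asboolP; rewrite subrr; exact: ideal0. Qed.
Lemma ideal_eqb_sym : symmetric ideal_eqb.
Proof.
by move=> x y; apply/asboolP/asboolP => /(idealZ hI (-1));
  rewrite scaleN1r opprB.
Qed.
Lemma ideal_eqb_trans : transitive ideal_eqb.
Proof.
move=> y x z /asboolP h /asboolP h'; apply/asboolP.
by have := idealD hI h h'; rewrite addrA subrK.
Qed.

Canonical ideal_equiv :=
  EquivRel ideal_eqb ideal_eqb_refl ideal_eqb_sym ideal_eqb_trans.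

Definition lie_quot := {eq_quot ideal_equiv}.
HB.instance Definition _ := Choice.on lie_quot.
HB.instance Definition _ := EqQuotient.on lie_quot.

Lemma lie_quotP (x y : L) : \pi_lie_quot x = \pi_lie_quot y <-> I (x - y).
Proof. by split=> [/eqmodP/asboolP //|h]; apply/eqmodP/asboolP. Qed.

Lemma lq_reprK x : \pi_lie_quot (repr x) = x. Proof. exact: reprK. Qed.
Lemma lq_reprE t : I (repr (\pi_lie_quot t) - t). Proof. by apply/lie_quotP; exact: lq_reprK. Qed.

Definition lq_add (x y : lie_quot) : lie_quot := \pi_lie_quot (repr x + repr y).
Definition lq_scale a (x : lie_quot) : lie_quot := \pi_lie_quot (a *: repr x).
Definition lq_lie (x y : lie_quot) : lie_quot := \pi_lie_quot (lie (repr x) (repr y)).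

Lemma lq_addE s t : lq_add (\pi_lie_quot s) (\pi_lie_quot t) = \pi_lie_quot (s + t).
Proof.
by apply/lie_quotP; rewrite opprD addrACA; apply: idealD => //; exact: lq_reprE.
Qed.
Lemma lq_scaleE a t : lq_scale a (\pi_lie_quot t) = \pi_lie_quot (a *: t).
Proof. by apply/lie_quotP; rewrite -scalerBr; apply: idealZ => //; exact: lq_reprE. Qed.
Lemma lq_lieE s t : lq_lie (\pi_lie_quot s) (\pi_lie_quot t) = \pi_lie_quot (lie s t).
Proof.
apply/lie_quotP; rewrite -(subrK (lie s (repr (\pi_lie_quot t))) (lie _ _)) -addrA.
rewrite -lieBl -lieBr [lie (_ - s) _]lie_anti -scaleN1r.
apply: idealD => //; first apply: idealZ => //; apply: ideal_lie => //; exact: lq_reprE.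
Qed.

Lemma lq_ind (P : lie_quot -> Prop) : (forall t, P (\pi_lie_quot t)) -> forall x, P x.
Proof. by move=> h x; rewrite -(lq_reprK x). Qed.

Lemma lq_addA : associative lq_add.
Proof. by do 3![elim/lq_ind => ?]; rewrite !lq_addE addrA. Qed.
Lemma lq_addC : commutative lq_add.
Proof. by do 2![elim/lq_ind => ?]; rewrite !lq_addE addrC. Qed.
Lemma lq_add0 : left_id (\pi_lie_quot 0) lq_add.
Proof. by elim/lq_ind => ?; rewrite lq_addE add0r. Qed.
Lemma lq_addN : left_inverse (\pi_lie_quot 0) (lq_scale (-1)) lq_add.
Proof. by elim/lq_ind => ?; rewrite lq_scaleE lq_addE scaleN1r addNr. Qed.
HB.instance Definition _ :=
  GRing.isZmodule.Build lie_quot lq_addA lq_addC lq_add0 lq_addN.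

Lemma lq_scaleA a b x : lq_scale a (lq_scale b x) = lq_scale (a * b) x.
Proof. by elim/lq_ind: x => ?; rewrite !lq_scaleE scalerA. Qed.
Lemma lq_scale1 : left_id 1 lq_scale.
Proof. by elim/lq_ind => ?; rewrite lq_scaleE scale1r. Qed.
Lemma lq_scaleDr : right_distributive lq_scale +%R.
Proof.
by move=> a; do 2![elim/lq_ind => ?]; rewrite /GRing.add /= !(lq_scaleE, lq_addE) scalerDr.
Qed.
Lemma lq_scaleDl x : {morph lq_scale^~ x : a b / a + b}.
Proof.
by elim/lq_ind: x => ? a b; rewrite [RHS]/GRing.add /= !(lq_scaleE, lq_addE) scalerDl.
Qed.
HB.instance Definition _ := GRing.Zmodule_isLmodule.Build K lie_quot
  lq_scaleA lq_scale1 lq_scaleDr lq_scaleDl.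

Lemma lq_paddE (s t : L) : \pi_lie_quot s + \pi_lie_quot t = \pi_lie_quot (s + t). Proof. exact: lq_addE. Qed.
Lemma lq_pscaleE a (t : L) : a *: \pi_lie_quot t = \pi_lie_quot (a *: t). Proof. exact: lq_scaleE. Qed.

Lemma lq_lieDl x y z : lq_lie (x + y) z = lq_lie x z + lq_lie y z.
Proof.
elim/lq_ind: x => s; elim/lq_ind: y => t; elim/lq_ind: z => u.
by rewrite !(lq_paddE, lq_lieE) lieDl.
Qed.
Lemma lq_lieDr x y z : lq_lie z (x + y) = lq_lie z x + lq_lie z y.
Proof.
elim/lq_ind: x => s; elim/lq_ind: y => t; elim/lq_ind: z => u.
by rewrite !(lq_paddE, lq_lieE) lieDr.
Qed.
Lemma lq_lieZl a x y : lq_lie (a *: x) y = a *: lq_lie x y.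
Proof.
by elim/lq_ind: x => s; elim/lq_ind: y => t; rewrite !(lq_pscaleE, lq_lieE) lieZl.
Qed.
Lemma lq_lieZr a x y : lq_lie y (a *: x) = a *: lq_lie y x.
Proof.
by elim/lq_ind: x => s; elim/lq_ind: y => t; rewrite !(lq_pscaleE, lq_lieE) lieZr.
Qed.
Lemma lq_liexx x : lq_lie x x = 0.
Proof. by elim/lq_ind: x => s; rewrite lq_lieE liexx. Qed.
Lemma lq_jacobi x y z :
  lq_lie x (lq_lie y z) + lq_lie y (lq_lie z x) + lq_lie z (lq_lie x y) = 0.
Proof.
elim/lq_ind: x => s; elim/lq_ind: y => t; elim/lq_ind: z => u.
by rewrite !(lq_lieE, lq_paddE) lie_jacobi.
Qed.
HB.instance Definition _ := isLieAlgebra.Build K lie_quot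
  lq_lieDl lq_lieDr lq_lieZl lq_lieZr lq_liexx lq_jacobi.

Definition lie_proj (x : L) : lie_quot := \pi_lie_quot x.

Lemma lie_projD x y : lie_proj (x + y) = lie_proj x + lie_proj y.
Proof. exact: esym (lq_paddE x y). Qed.
Lemma lie_projZ a x : lie_proj (a *: x) = a *: lie_proj x.
Proof. exact: esym (lq_pscaleE a x). Qed.
Lemma lie_proj_lie x y : lie_proj (lie x y) = lie (lie_proj x) (lie_proj y).
Proof. exact: esym (lq_lieE x y). Qed.
Lemma lie_proj_eq0 x : lie_proj x = 0 <-> I x.
Proof. by have := lie_quotP x 0; rewrite subr0. Qed.
Lemma lie_proj_surj (y : lie_quot) : exists x, lie_proj x = y.
Proof. by exists (repr y); exact: lq_reprK. Qed.

End Quotient.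

(** The degree completion of a Lie algebra graded by the degree in the
    generators [G] is the product of its homogeneous components. *)
Record completion (K : fieldType) (L : lieAlgType K) (G : set L) := Completion {
  hcomp : nat -> L;
  hcompP : forall d, homog G d (hcomp d)
}.

HB.instance Definition _ K L G := gen_eqMixin (@completion K L G).
HB.instance Definition _ K L G := gen_choiceMixin (@completion K L G).

Section Completion.
Variables (K : fieldType) (L : lieAlgType K) (G : set L).
Notation Lhat := (completion G).
Implicit Types x y z : Lhat.

Lemma hcomp_inj x y : (forall d, hcomp x d = hcomp y d) -> x = y.
Proof.
case: x y => [f hf] [g hg] /= h; have e : f = g by apply/funext.
by case: _ / e in hg *; congr Completion; exact: Prop_irrelevance.
Qed.

Lemma hcomp0 x : hcomp x 0 = 0.
Proof. exact: homog_deg0 (hcompP x 0). Qed.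

Definition lh_zero : Lhat := Completion (fun d => homog0 G d).
Definition lh_add x y : Lhat :=
  Completion (fun d => homogD (hcompP x d) (hcompP y d)).
Definition lh_opp x : Lhat := Completion (fun d => homogN (hcompP x d)).
Definition lh_scale a x : Lhat := Completion (fun d => homogZ a (hcompP x d)).

Lemma lh_lie_subproof x y d :
  homog G d (\sum_(i < d.+1) lie (hcomp x i) (hcomp y (d - i))).
Proof.
apply: homog_sum => i _; rewrite -{1}(subnKC (ltn_ord i : i <= d)%N).
by apply: homog_lie; exact: hcompP.
Qed.
Definition lh_lie x y : Lhat := Completion (lh_lie_subproof x y).

Lemma lh_addA : associative lh_add.
Proof. by move=> x y z; apply: hcomp_inj => d /=; rewrite addrA. Qed.
Lemma lh_addC : commutative lh_add.
Proof. by move=> x y; apply: hcomp_inj => d /=; rewrite addrC. Qed.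
Lemma lh_add0 : left_id lh_zero lh_add.
Proof. by move=> x; apply: hcomp_inj => d /=; rewrite add0r. Qed.
Lemma lh_addN : left_inverse lh_zero lh_opp lh_add.
Proof. by move=> x; apply: hcomp_inj => d /=; rewrite addNr. Qed.
HB.instance Definition _ :=
  GRing.isZmodule.Build Lhat lh_addA lh_addC lh_add0 lh_addN.

Lemma lh_scaleA a b x : lh_scale a (lh_scale b x) = lh_scale (a * b) x.
Proof. by apply: hcomp_inj => d /=; rewrite scalerA. Qed.
Lemma lh_scale1 : left_id 1 lh_scale.
Proof. by move=> x; apply: hcomp_inj => d /=; rewrite scale1r. Qed.
Lemma lh_scaleDr : right_distributive lh_scale +%R.
Proof. by move=> a x y; apply: hcomp_inj => d /=; rewrite scalerDr. Qed.
Lemma lh_scaleDl x : {morph lh_scale^~ x : a b / a + b}.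
Proof. by move=> a b; apply: hcomp_inj => d /=; rewrite scalerDl. Qed.
HB.instance Definition _ := GRing.Zmodule_isLmodule.Build K Lhat
  lh_scaleA lh_scale1 lh_scaleDr lh_scaleDl.

Lemma lh_lieDl x y z : lh_lie (x + y) z = lh_lie x z + lh_lie y z.
Proof.
by apply: hcomp_inj => d /=; rewrite -big_split; apply: eq_bigr => i _; rewrite lieDl.
Qed.
Lemma lh_lieDr x y z : lh_lie z (x + y) = lh_lie z x + lh_lie z y.
Proof.
by apply: hcomp_inj => d /=; rewrite -big_split; apply: eq_bigr => i _; rewrite lieDr.
Qed.
Lemma lh_lieZl a x y : lh_lie (a *: x) y = a *: lh_lie x y.
Proof.
by apply: hcomp_inj => d /=; rewrite scaler_sumr; apply: eq_bigr => i _; rewrite lieZl.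
Qed.
Lemma lh_lieZr a x y : lh_lie y (a *: x) = a *: lh_lie y x.
Proof.
by apply: hcomp_inj => d /=; rewrite scaler_sumr; apply: eq_bigr => i _; rewrite lieZr.
Qed.

Lemma lh_lieE x y d : hcomp (lh_lie x y) d =
  \sum_(i < d.+1) \sum_(j < d.+1 | (i + j == d)%N) lie (hcomp x i) (hcomp y j).
Proof.
apply: eq_bigr => i _; have id : (i <= d)%N by rewrite -ltnS.
have jd : (d - i < d.+1)%N by rewrite ltnS leq_subr.
rewrite (big_pred1 (Ordinal jd)) // => j /=.
by rewrite -val_eqE /= -[RHS](eqn_add2l i) subnKC.
Qed.

Lemma lh_liexx x : lh_lie x x = 0.
Proof.
apply: hcomp_inj => d; rewrite lh_lieE.
have -> : \sum_(i < d.+1) \sum_(j < d.+1 | (i + j == d)%N)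
            lie (hcomp x i) (hcomp x j) =
          \sum_(i < d.+1) (\sum_(j < d.+1 | (i + j == d)%N && (i < j)%N)
            lie (hcomp x i) (hcomp x j) +
            \sum_(j < d.+1 | (i + j == d)%N && (j < i)%N)
            lie (hcomp x i) (hcomp x j)).
  apply: eq_bigr => i _; rewrite (bigID (fun j : 'I_d.+1 => (i < j)%N)) /=.
  congr (_ + _); rewrite (bigID (fun j : 'I_d.+1 => (j < i)%N)) /=.
  rewrite [X in _ + X]big1 ?addr0 => [|j].
    by apply: eq_bigl => j; case: ltngtP => //; rewrite !(andbT, andbF).
  rewrite -!leqNgt => /andP[/andP[_ ji] ij].
  by have -> : i = j by [apply/val_inj/eqP; rewrite eqn_leq ij ji]; rewrite liexx.
rewrite big_split /= [X in _ + X](exchange_big_dep predT) //= -big_split /=.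
rewrite big1 // => i _; rewrite -[X in X + _]opprK addrC -sumrN; apply/eqP.
rewrite subr_eq0; apply/eqP/eq_big => j; first by rewrite addnC.
by move=> _; rewrite [LHS]lie_anti.
Qed.

Lemma lh_lie3 x y z d (N := d.+1) : hcomp (lh_lie x (lh_lie y z)) d =
  \sum_(i < N) \sum_(j < N) \sum_(k < N | (i + j + k == d)%N)
     lie (hcomp x i) (lie (hcomp y j) (hcomp z k)).
Proof.
have aux1 (a b c e : nat) : (e - a < b)%N -> (a + b + c)%N = e -> False by lia.
have aux2 (a b c e : nat) : (a <= e)%N -> (b < (e - a).+1)%N ->
  (a + b + c == e)%N = (c == e - a - b)%N by lia.
apply: eq_bigr => i _; have id : (i <= d)%N by rewrite -ltnS.
rewrite lie_sumr [RHS](bigID (fun j : 'I_N => (j < (d - i).+1)%N)) /=.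
rewrite [X in _ = _ + X]big1 ?addr0 => [|j]; last first.
  rewrite -leqNgt => h; apply: big1 => k /eqP e.
  by case: (aux1 _ _ _ _ h e).
have le1 : ((d - i).+1 <= N)%N by rewrite ltnS leq_subr.
rewrite (big_ord_widen N (fun j => lie (hcomp x i)
  (lie (hcomp y j) (hcomp z (d - i - j)))) le1).
apply: eq_bigr => j jd; have kd : (d - i - j < N)%N.
  by rewrite ltnS (leq_trans (leq_subr _ _)) // leq_subr.
rewrite (big_pred1 (Ordinal kd)) // => k /=.
by rewrite -val_eqE /=; exact: aux2.
Qed.

Lemma lh_jacobi x y z :
  lh_lie x (lh_lie y z) + lh_lie y (lh_lie z x) + lh_lie z (lh_lie x y) = 0.
Proof.
apply: hcomp_inj => d; rewrite -[LHS]/(hcomp (lh_lie x (lh_lie y z)) d + hcomp (lh_lie y (lh_lie z x)) d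
  + hcomp (lh_lie z (lh_lie x y)) d) !lh_lie3.
pose N := d.+1.
have -> : \sum_(i < N) \sum_(j < N) \sum_(k < N | (i + j + k == d)%N)
     lie (hcomp y i) (lie (hcomp z j) (hcomp x k)) =
   \sum_(i < N) \sum_(j < N) \sum_(k < N | (i + j + k == d)%N)
     lie (hcomp y j) (lie (hcomp z k) (hcomp x i)).
  transitivity (\sum_(i < N) \sum_(k < N) \sum_(j < N | (i + j + k == d)%N)
     lie (hcomp y i) (lie (hcomp z j) (hcomp x k))).
    by apply: eq_bigr => i _; rewrite (exchange_big_dep predT).
  rewrite exchange_big /=; apply: eq_bigr => k _; apply: eq_bigr => i _.
  by apply: eq_bigl => j; rewrite addnAC [(k + i)%N]addnC addnAC addnAC.
have -> : \sum_(i < N) \sum_(j < N) \sum_(k < N | (i + j + k == d)%N)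
     lie (hcomp z i) (lie (hcomp x j) (hcomp y k)) =
   \sum_(i < N) \sum_(j < N) \sum_(k < N | (i + j + k == d)%N)
     lie (hcomp z k) (lie (hcomp x i) (hcomp y j)).
  rewrite exchange_big /=; apply: eq_bigr => j _.
  rewrite (exchange_big_dep predT) //=; apply: eq_bigr => k _.
  by apply: eq_bigl => i; rewrite -addnA addnC.
rewrite -!big_split /= big1 // => i _; rewrite -!big_split big1 // => j _.
by rewrite -!big_split big1 // => k _ /=; rewrite lie_jacobi.
Qed.
HB.instance Definition _ := isLieAlgebra.Build K Lhat
  lh_lieDl lh_lieDr lh_lieZl lh_lieZr lh_liexx lh_jacobi.

(** [csum u] is the sum of the series [\sum_m u m], where [u m] is required to
    have no component of degree less than [m]. *)
Lemma csum_subproof (u : nat -> Lhat) d :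
  homog G d (\sum_(m < d.+1) hcomp (u m) d).
Proof. by apply: homog_sum => m _; exact: hcompP. Qed.
Definition csum (u : nat -> Lhat) : Lhat := Completion (csum_subproof u).

(** [[x^k y^l x y]] *)
Definition br_word (k l : nat) x y : Lhat :=
  lbr (nseq k x ++ nseq l y ++ [:: x; y]).

Definition phi_part (alpha : nat -> nat -> K) x y (m : nat) : Lhat :=
  \sum_(k < m.+1) alpha k (m - k)%N *: br_word k (m - k) x y.

(** [\sum_(k, l) alpha k l [x^k y^l x y]], the terms being grouped by
    [m = k + l]. *)
Definition phibar alpha x y : Lhat := csum (phi_part alpha x y).

(** The sum of the terms of length [m] of the Campbell-Baker-Hausdorff series in
    Dynkin's form
      \sum_n (-1)^(n-1)/n \sum_(r_1, s_1, ..., r_n, s_n, each r_i + s_i > 0)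
        [x^r_1 y^s_1 ... x^r_n y^s_n]
          / ((\sum_i (r_i + s_i)) \prod_i r_i! s_i!);
    an entry of the tuple [p] is a pair [(r_i, s_i)]. *)
Definition cbh_part x y (m : nat) : Lhat :=
  \sum_(1 <= n < m.+1)
    \sum_(p : n.-tuple ('I_m.+1 * 'I_m.+1) |
            all (fun q => 0 < nat_of_ord q.1 + nat_of_ord q.2)%N p &&
            (\sum_(q <- p) (nat_of_ord q.1 + nat_of_ord q.2) == m)%N)
      ((-1) ^+ n.-1 / (n * m * \prod_(q <- p) ((nat_of_ord q.1)`! * (nat_of_ord q.2)`!))%N%:R) *:
        lbr (flatten [seq nseq (nat_of_ord q.1) x ++ nseq (nat_of_ord q.2) y | q <- p]).

Definition cbh x y : Lhat := csum (cbh_part x y).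

(** [log (e^{x_1} ... e^{x_k})] for [s = [:: x_1; ...; x_k]] *)
Definition log_prod_exp (s : seq Lhat) : Lhat := foldr cbh 0 s.

Lemma hcomp_sum (I : Type) (r : seq I) (P : pred I) (F : I -> Lhat) d :
  hcomp (\sum_(i <- r | P i) F i) d = \sum_(i <- r | P i) hcomp (F i) d.
Proof.
by apply: (big_morph (fun x => hcomp x d) (op1 := +%R) (id1 := 0)).
Qed.

Lemma hcomp_lbr (s : seq Lhat) d : (d < size s)%N -> hcomp (lbr s) d = 0.
Proof.
have aux (a b c : nat) : (a < b.+2)%N -> (c.+1 < a.+1)%N -> (a - c.+1 < b.+1)%N.
  by lia.
elim: s d => // x [|y s] IH d ds.
  by case: d ds => // _; exact: hcomp0.
rewrite [lbr _]/= -[hcomp _ d]/(\sum_(i < d.+1) lie (hcomp x i)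
  (hcomp (lbr (y :: s)) (d - i))).
rewrite big1 // => -[[|i] id] _; first by rewrite hcomp0 lie0x.
by rewrite IH ?liex0 //; exact: aux ds id.
Qed.

Lemma phi_part_order alpha x y m d :
  (d < m)%N -> hcomp (phi_part alpha x y m) d = 0.
Proof.
move=> dm; rewrite hcomp_sum big1 // => k _.
rewrite -[hcomp _ d]/(_ *: hcomp (br_word k (m - k) x y) d).
rewrite hcomp_lbr ?scaler0 // !size_cat !size_nseq addnA subnKC.
  by rewrite (leq_trans dm) ?leq_addr.
by rewrite -ltnS.
Qed.

Lemma cbh_part_order x y m d : (d < m)%N -> hcomp (cbh_part x y m) d = 0.
Proof.
move=> dm; rewrite hcomp_sum big1 // => n _; rewrite hcomp_sum big1 //.
move=> p /andP[_ /eqP pm].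
rewrite -[hcomp _ d]/(_ *: hcomp (lbr _) d) hcomp_lbr ?scaler0 //.
rewrite size_flatten /shape -map_comp sumnE big_map.
rewrite (eq_bigr (fun q : 'I_m.+1 * 'I_m.+1 => q.1 + q.2)%N) ?pm // => q _.
by rewrite /= size_cat !size_nseq.
Qed.

End Completion.

Arguments Completion {K L G}.
Arguments phibar {K L G}.

Section Chord.
Variables (K : fieldType) (n : nat).

Definition chord : Type := {p : 'I_n * 'I_n | p.1 != p.2}.

Definition tterm (i j : 'I_n) (h : i != j) : lie_term K chord :=
  LGen (exist (fun p : 'I_n * 'I_n => p.1 != p.2) (i, j) h).

Inductive chord_rel : set (lie_term K chord) :=
| chord_sym i j (hij : i != j) (hji : j != i) :
    chord_rel (LSub (tterm hij) (tterm hji))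
| chord_comm i j k l (hij : i != j) (hkl : k != l) :
    uniq [:: i; j; k; l] ->
    chord_rel (LBr (tterm hij) (tterm hkl))
| chord_4T i j k (hij : i != j) (hjk : j != k) (hki : k != i) :
    chord_rel (LSub (LBr (tterm hij) (tterm hjk)) (LBr (tterm hjk) (tterm hki)))
| chord_4T' i j k (hij : i != j) (hjk : j != k) (hki : k != i) :
    chord_rel (LSub (LBr (tterm hjk) (tterm hki)) (LBr (tterm hki) (tterm hij))).

Definition Lie_n : lieAlgType K := presented chord_rel.

Definition Lbar : lieAlgType K := lie_quot (derived2_ideal Lie_n).

Definition tbar (i j : 'I_n) (h : i != j) : Lbar :=
  lie_proj (derived2_ideal Lie_n) (\pi_(presented chord_rel) (tterm h)).

Definition tgens : set Lbar := [set x | exists i j (h : i != j), x = tbar h].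

Definition Lbarhat : lieAlgType K := completion tgens.

Lemma that_subproof (i j : 'I_n) (h : i != j) d :
  homog tgens d (if d == 1%N then tbar h else 0).
Proof.
case: eqP => [->|_]; last exact: homog0.
by apply: homog_gen; exists i, j, h.
Qed.

Definition that (i j : 'I_n) (h : i != j) : Lbarhat :=
  Completion _ (that_subproof h).

End Chord.

(** [t^{ij}] in the completed quotient of [L_n], for numerals
    [1 <= i <> j <= n]; the strand [i] is the element [i - 1] of ['I_n]. *)
Notation "''t[' K , n ]_ ( i , j )" :=
  (@that K n (@Ordinal n i.-1 isT) (@Ordinal n j.-1 isT) isT)
  (at level 8, K, n, i, j at level 50, format "''t[' K ,  n ]_ ( i ,  j )").

Section Equations.
Variables (K : fieldType) (alpha : nat -> nat -> K).

Definition compressed_hexagon : Prop :=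
  let a := 't[K, 3]_(1, 2) in
  let b := 't[K, 3]_(2, 3) in
  let c := 't[K, 3]_(1, 3) in
  b + c = log_prod_exp
    [:: phibar alpha c a; c; - phibar alpha c b; b; phibar alpha a b].

Definition compressed_pentagon : Prop :=
  let t12 := 't[K, 4]_(1, 2) in
  let t13 := 't[K, 4]_(1, 3) in
  let t23 := 't[K, 4]_(2, 3) in
  let t24 := 't[K, 4]_(2, 4) in
  let t34 := 't[K, 4]_(3, 4) in
  log_prod_exp [:: phibar alpha t23 t34;
                   phibar alpha (t12 + t13) (t24 + t34);
                   phibar alpha t12 t23] =
  log_prod_exp [:: phibar alpha t12 (t23 + t24);
                   phibar alpha (t13 + t23) t34].

End Equations.

(** [coef2 f k l] is the coefficient of [lambda^k mu^l]. *)
Record fps2 (K : Type) := Fps2 { coef2 : nat -> nat -> K }.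

HB.instance Definition _ K := gen_eqMixin (fps2 K).
HB.instance Definition _ K := gen_choiceMixin (fps2 K).

Section PowerSeries.
Variable K : fieldType.
Implicit Types f g h : fps2 K.

Lemma coef2_inj f g : (forall i j, coef2 f i j = coef2 g i j) -> f = g.
Proof.
by case: f g => [f] [g] /= h; congr Fps2; apply/funext => i; apply/funext => j.
Qed.

Definition fps_add f g := Fps2 (fun i j => coef2 f i j + coef2 g i j).
Definition fps_opp f := Fps2 (fun i j => - coef2 f i j).
Definition fps_mul f g := Fps2 (fun i j =>
  \sum_(a < i.+1) \sum_(b < j.+1) coef2 f a b * coef2 g (i - a) (j - b)).
Definition fps_scale a f := Fps2 (fun i j => a * coef2 f i j).
Definition fps_one : fps2 K := Fps2 (fun i j => ((i == 0%N) && (j == 0%N))%:R).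

Lemma fps_addA : associative fps_add.
Proof. by move=> f g h; apply: coef2_inj => i j /=; rewrite addrA. Qed.
Lemma fps_addC : commutative fps_add.
Proof. by move=> f g; apply: coef2_inj => i j /=; rewrite addrC. Qed.
Lemma fps_add0 : left_id (Fps2 (fun _ _ => 0)) fps_add.
Proof. by move=> f; apply: coef2_inj => i j /=; rewrite add0r. Qed.
Lemma fps_addN : left_inverse (Fps2 (fun _ _ => 0)) fps_opp fps_add.
Proof. by move=> f; apply: coef2_inj => i j /=; rewrite addNr. Qed.
HB.instance Definition _ :=
  GRing.isZmodule.Build (fps2 K) fps_addA fps_addC fps_add0 fps_addN.

(* the ring axioms are transported from {poly {poly K}} by truncation *)
Definition fps_trunc N f : {poly {poly K}} := \poly_(i < N) \poly_(j < N) coef2 f i j.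

Lemma fps_truncE N f i j : (i < N)%N -> (j < N)%N -> (fps_trunc N f)`_i`_j = coef2 f i j.
Proof. by move=> iN jN; rewrite coef_poly iN coef_poly jN. Qed.

Lemma coef2_polyM (P Q : {poly {poly K}}) i j : (P * Q)`_i`_j =
  \sum_(a < i.+1) \sum_(b < j.+1) P`_a`_b * Q`_(i - a)`_(j - b).
Proof.
by rewrite coefM coef_sum; apply: eq_bigr => a _; rewrite coefM.
Qed.

Lemma fps_mulE N f g i j (P Q : {poly {poly K}}) : (i < N)%N -> (j < N)%N ->
  (forall a b, (a < N)%N -> (b < N)%N -> P`_a`_b = coef2 f a b) ->
  (forall a b, (a < N)%N -> (b < N)%N -> Q`_a`_b = coef2 g a b) ->
  coef2 (fps_mul f g) i j = (P * Q)`_i`_j.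
Proof.
move=> iN jN hP hQ; rewrite coef2_polyM /=; apply: eq_bigr => a _; apply: eq_bigr => b _.
have [ai bj] := (ltn_ord a, ltn_ord b); rewrite !ltnS in ai bj.
rewrite hP ?hQ //; do ?[by apply: leq_ltn_trans (leq_subr _ _) _];
  by [apply: leq_ltn_trans iN | apply: leq_ltn_trans jN].
Qed.

Lemma fps_mulC : commutative fps_mul.
Proof.
move=> f g; apply: coef2_inj => i j; pose N := (i + j).+1.
have iN : (i < N)%N by rewrite ltnS leq_addr.
have jN : (j < N)%N by rewrite ltnS leq_addl.
rewrite (fps_mulE iN jN (fps_truncE f) (fps_truncE g)).
by rewrite (fps_mulE iN jN (fps_truncE g) (fps_truncE f)) mulrC.
Qed.

Lemma fps_mulA : associative fps_mul.
Proof.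
move=> f g h; apply: coef2_inj => i j; pose N := (i + j).+1.
have iN : (i < N)%N by rewrite ltnS leq_addr.
have jN : (j < N)%N by rewrite ltnS leq_addl.
have M u v a b : (a < N)%N -> (b < N)%N ->
    (fps_trunc N u * fps_trunc N v)`_a`_b = coef2 (fps_mul u v) a b.
  by move=> aN bN; rewrite (fps_mulE aN bN (fps_truncE u) (fps_truncE v)).
rewrite (fps_mulE iN jN (fps_truncE f) (M g h)).
by rewrite (fps_mulE iN jN (M f g) (fps_truncE h)) mulrA.
Qed.

Lemma fps_mul1 : left_id fps_one fps_mul.
Proof.
move=> f; apply: coef2_inj => i j; pose N := (i + j).+1.
have iN : (i < N)%N by rewrite ltnS leq_addr.
have jN : (j < N)%N by rewrite ltnS leq_addl.
rewrite (@fps_mulE N _ _ _ _ 1 _ iN jN _ (fps_truncE f)) ?mul1r ?fps_truncE // => a b _ _.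
by rewrite coef1 /=; case: (a == 0%N); rewrite ?coef1 ?coef0.
Qed.

Lemma fps_mulDl : left_distributive fps_mul +%R.
Proof.
move=> f g h; apply: coef2_inj => i j /=; rewrite -big_split; apply: eq_bigr => a _.
by rewrite -big_split; apply: eq_bigr => b _; rewrite mulrDl.
Qed.

Lemma fps_1neq0 : fps_one != 0.
Proof.
by apply/eqP => /(congr1 (fun f => coef2 f 0 0)) /= /eqP; rewrite oner_eq0.
Qed.
HB.instance Definition _ := GRing.Zmodule_isComNzRing.Build (fps2 K)
  fps_mulA fps_mulC fps_mul1 fps_mulDl fps_1neq0.

Lemma fps_scaleA a b f : fps_scale a (fps_scale b f) = fps_scale (a * b) f.
Proof. by apply: coef2_inj => i j /=; rewrite mulrA. Qed.
Lemma fps_scale1 : left_id 1 fps_scale.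
Proof. by move=> f; apply: coef2_inj => i j /=; rewrite mul1r. Qed.
Lemma fps_scaleDr : right_distributive fps_scale +%R.
Proof. by move=> a f g; apply: coef2_inj => i j /=; rewrite mulrDr. Qed.
Lemma fps_scaleDl f : {morph fps_scale^~ f : a b / a + b}.
Proof. by move=> a b; apply: coef2_inj => i j /=; rewrite mulrDl. Qed.
HB.instance Definition _ := GRing.Zmodule_isLmodule.Build K (fps2 K)
  fps_scaleA fps_scale1 fps_scaleDr fps_scaleDl.

Definition lam : fps2 K := Fps2 (fun i j => ((i == 1%N) && (j == 0%N))%:R).
Definition mu : fps2 K := Fps2 (fun i j => ((i == 0%N) && (j == 1%N))%:R).

(** [fps_sum u] is the sum of the series [\sum_m u m], where [u m] is required
    to have no term of total degree less than [m]. *)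
Definition fps_sum (u : nat -> fps2 K) : fps2 K :=
  Fps2 (fun i j => \sum_(m < (i + j).+1) coef2 (u m) i j).

(** [e^f], for [f] without constant term *)
Definition fps_exp f : fps2 K := fps_sum (fun m => (m`!%:R)^-1 *: f ^+ m).

(** [f(g, h)], for [g] and [h] without constant term *)
Definition fps_subst f g h : fps2 K := fps_sum (fun m =>
  \sum_(k < m.+1) coef2 f k (m - k)%N *: (g ^+ k * h ^+ (m - k))).

(** The exact quotient [f / g]: the series [q] with [g * q = f] (unique when
    [g] is nonzero), if there is one. *)
Definition fps_div f g : fps2 K := xget 0 [set q | g * q = f].

Lemma coef2D f g i j : coef2 (f + g) i j = coef2 f i j + coef2 g i j.
Proof. by []. Qed.
Lemma coef2N f i j : coef2 (- f) i j = - coef2 f i j.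
Proof. by []. Qed.
Lemma coef2Z a f i j : coef2 (a *: f) i j = a * coef2 f i j.
Proof. by []. Qed.
Lemma coef2_1 i j : coef2 (1 : fps2 K) i j = ((i == 0%N) && (j == 0%N))%:R.
Proof. by []. Qed.
Lemma coef2M f g i j : coef2 (f * g) i j =
  \sum_(a < i.+1) \sum_(b < j.+1) coef2 f a b * coef2 g (i - a) (j - b).
Proof. by []. Qed.

Lemma coef2_lamM f i j :
  coef2 (lam * f) i j = if i is i'.+1 then coef2 f i' j else 0.
Proof.
rewrite coef2M big_ord_recl big1 ?add0r => [|b _]; last by rewrite mul0r.
case: i => [|i]; first by rewrite big_ord0.
rewrite big_ord_recl [X in _ + X]big1 ?addr0 => [|a _]; last first.
  by rewrite big1 // => b _; rewrite mul0r.
rewrite big_ord_recl [X in _ + X]big1 ?addr0 => [|b _]; last by rewrite mul0r.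
by rewrite mul1r subn0 /= /bump /= subSS subn0.
Qed.

Lemma coef2_muM f i j :
  coef2 (mu * f) i j = if j is j'.+1 then coef2 f i j' else 0.
Proof.
rewrite coef2M big_ord_recl [X in _ + X]big1 ?addr0 => [|a _]; last first.
  by rewrite big1 // => b _; rewrite mul0r.
rewrite big_ord_recl mul0r add0r.
case: j => [|j]; first by rewrite big_ord0.
rewrite big_ord_recl [X in _ + X]big1 ?addr0 => [|b _]; last by rewrite mul0r.
by rewrite mul1r subn0 /= /bump /= subSS subn0.
Qed.

Lemma lam_reg f : lam * f = 0 -> f = 0.
Proof.
move=> h; apply: coef2_inj => i j.
by have := congr1 (fun g => coef2 g i.+1 j) h; rewrite coef2_lamM.
Qed.

Lemma mu_reg f : mu * f = 0 -> f = 0.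
Proof.
move=> h; apply: coef2_inj => i j.
by have := congr1 (fun g => coef2 g i j.+1) h; rewrite coef2_muM.
Qed.

Lemma lam_mu_reg f : (lam + mu) * f = 0 -> f = 0.
Proof.
move=> h; apply: coef2_inj; elim=> [|i IH] j;
  have := congr1 (fun g => coef2 g _ j.+1) h; [move/(_ 0%N) | move/(_ i.+1)];
  by rewrite mulrDl coef2D coef2_lamM coef2_muM ?IH add0r.
Qed.

Lemma fps_divE f g q :
  (forall h, g * h = 0 -> h = 0) -> g * q = f -> fps_div f g = q.
Proof.
move=> reg e; rewrite /fps_div; apply: xget_unique => // q' /= e'.
by apply/eqP; rewrite -subr_eq0; apply/eqP/reg; rewrite mulrBr e e' subrr.
Qed.

Lemma coef2_exp f i j : coef2 (fps_exp f) i j =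
  \sum_(m < (i + j).+1) m`!%:R^-1 * coef2 (f ^+ m) i j.
Proof. by []. Qed.

Lemma coef2_muX n i j : coef2 (mu ^+ n) i j = ((i == 0%N) && (j == n))%:R.
Proof.
elim: n j => [|n IH] j //; rewrite exprS coef2_muM.
by case: j => [|j]; rewrite ?andbF // IH.
Qed.

Lemma coef2_lamX n i j : coef2 (lam ^+ n) i j = ((i == n) && (j == 0%N))%:R.
Proof.
elim: n i => [|n IH] i //; rewrite exprS coef2_lamM.
by case: i => [|i]; rewrite ?andbF // IH.
Qed.

(* the three divisions by [lambda], [mu] and [lambda + mu] below are exact *)
Definition exp_quot_mu : fps2 K :=
  Fps2 (fun i j => (i == 0%N)%:R / j.+1`!%:R).
Definition exp_quot_lam : fps2 K :=
  Fps2 (fun i j => (j == 0%N)%:R * (-1) ^+ i.+1 / i.+1`!%:R).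
Definition exp_quot_lam_mu : fps2 K :=
  Fps2 (fun i j => (-1) ^+ i / (i + j).+2`!%:R).

Lemma fps_div_exp_mu : fps_div (fps_exp mu - 1) mu = exp_quot_mu.
Proof.
apply: fps_divE; first exact: mu_reg.
apply: coef2_inj => i j; rewrite coef2_muM coef2D coef2N coef2_1 coef2_exp.
under eq_bigr do rewrite coef2_muX.
case: i => [|i] /=; last first.
  by rewrite big1 ?subrr => [|m _]; [case: j => // j; rewrite mul0r | rewrite mulr0].
rewrite add0n (bigD1 (ord_max : 'I_j.+1)) //= eqxx mulr1 big1 ?addr0 => [|m mj].
  by case: j => [|j]; rewrite ?fact0 ?invr1 ?subrr // subr0 mul1r.
by rewrite eq_sym -[_ == _ :> nat]/(m == ord_max) (negPf mj) mulr0.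
Qed.

Lemma fps_div_exp_lam : fps_div (fps_exp (- lam) - 1) lam = exp_quot_lam.
Proof.
apply: fps_divE; first exact: lam_reg.
have lamNX m i j : coef2 ((- lam) ^+ m) i j = (-1) ^+ m * coef2 (lam ^+ m) i j.
  elim: m i j => [|m IH] i j; first by rewrite !expr0 mul1r.
  rewrite [in LHS]exprS [in X in coef2 X](mulNr lam) coef2N coef2_lamM.
  rewrite [lam ^+ _]exprS coef2_lamM.
  by case: i => [|i]; rewrite ?mulr0 ?oppr0 // IH exprS mulN1r mulNr.
apply: coef2_inj => i j; rewrite coef2_lamM coef2D coef2N coef2_1 coef2_exp.
under eq_bigr do rewrite lamNX coef2_lamX.
case: j => [|j] /=; last first.
  by rewrite andbF big1 ?subrr => [|m _]; [case: i => // i; rewrite !mul0r |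
    rewrite andbF !mulr0].
rewrite addn0 (bigD1 (ord_max : 'I_i.+1)) //= eqxx mulr1 big1 ?addr0 => [|m mi].
  case: i => [|i]; rewrite ?fact0 ?invr1 ?mulr1 ?expr0 ?subrr // subr0 mul1r.
  by rewrite mulrC.
by rewrite andbT eq_sym -[_ == _ :> nat]/(m == ord_max) (negPf mi) !mulr0.
Qed.

Lemma fps_div_exp_lam_mu :
  fps_div (fps_div (fps_exp mu - 1) mu + fps_div (fps_exp (- lam) - 1) lam)
          (lam + mu) = exp_quot_lam_mu.
Proof.
rewrite fps_div_exp_mu fps_div_exp_lam; apply: fps_divE; first exact: lam_mu_reg.
apply: coef2_inj => i j; rewrite mulrDl !coef2D coef2_lamM coef2_muM /=.
case: i j => [|i] [|j] /=; rewrite ?mul0r ?mul1r ?addr0 ?add0r ?addn0 ?add0n //.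
- by rewrite expr1 mulN1r subrr.
- by rewrite !exprS !mulN1r opprK.
- by rewrite addnS addSn exprS mulN1r mulNr subrr.
Qed.

End PowerSeries.

Arguments lam {K}.
Arguments mu {K}.

(* Main.v *)
Require Import Defs.
From HB Require Import structures.
From mathcomp Require Import all_boot all_order all_algebra.
From mathcomp Require Import boolp classical_sets reals complex zify ring.

(** In a metabelian Lie algebra the derived subalgebra is a module over
    commuting operators, so everything is computed by power series. The words of
    Dynkin's series sum to a series [H(ad x, ad y)] applied to [[x, y]]; with
    [E = e^(x + y) - 1], a first order differential equation for the Euler
    operator gives [E H = e^x (e^y - 1) / y - (e^x - 1) / x]. In the
    three-strand algebra with [w = [a, b]], the derived elements are [f w] for
    series [f] in [ad a] and [ad b], and [ad c = - ad a - ad b]; multiplying the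
    five factors of the hexagon therefore gives [b + c + g w] for an explicit
    [g], which vanishes exactly when the stated identity holds. That [g w = 0]
    forces [g = 0] is seen in a Magnus-type representation.

    In the pentagon all factors commute, so it is a linear identity. Write
    [w_ijk = [t^ij, t^jk]]. The relation [t^il w_ijk = - t^jk w_ijl] shows that
    [t^il w_ijk] is killed by the four triangle sums, hence that opposite edges
    act equally on it. Up to such terms each face [w_ijk] only sees its own
    edges; the leftovers satisfy recursions that make them antisymmetric under
    exchanging the two exponents, and cancel against a symmetric [alpha]. *)

Set Implicit Arguments.
Unset Strict Implicit.
Unset Printing Implicit Defensive.

Import Order.TTheory GRing.Theory Num.Theory.
Local Open Scope ring_scope.

(** * Formal power series in two variables *)

Section PowerSeriesTools.
Variable K : numFieldType.
Implicit Types (f g h t u v : fps2 K) (c : nat -> K).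

Lemma coef2_sum (I : Type) (r : seq I) (P : pred I) (F : I -> fps2 K) i j :
  coef2 (\sum_(n <- r | P n) F n) i j = \sum_(n <- r | P n) coef2 (F n) i j.
Proof. exact: (big_morph (fun f => coef2 f i j) (op1 := +%R) (id1 := 0)). Qed.

Lemma fps_scaleAl a f g : a *: (f * g) = (a *: f) * g.
Proof.
apply: coef2_inj => i j; rewrite coef2Z !coef2M mulr_sumr.
apply: eq_bigr => k _; rewrite mulr_sumr; apply: eq_bigr => l _.
by rewrite coef2Z mulrA.
Qed.

Lemma fps_scaleAr a f g : a *: (f * g) = f * (a *: g).
Proof. by rewrite mulrC fps_scaleAl mulrC. Qed.

Definition ford (d : nat) f := forall i j, (i + j < d)%N -> coef2 f i j = 0.
(** Zero counts as homogeneous of every degree: it later stands for the action of a derived element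
    and must satisfy [hdeg 1]. *)
Definition hdeg (d : nat) f := forall i j, (i + j != d)%N -> coef2 f i j = 0.

Lemma ford0 f : ford 0 f. Proof. by []. Qed.

Lemma fordM d e f g : ford d f -> ford e g -> ford (d + e) (f * g).
Proof.
move=> hf hg i j ij; rewrite coef2M big1 // => k _; rewrite big1 // => l _.
have [ki lj] := (ltn_ord k, ltn_ord l).
have [kl|kl] := ltnP (k + l) d; first by rewrite hf ?mul0r.
by rewrite [X in _ * X]hg ?mulr0 //; lia.
Qed.

Lemma fordZ d a f : ford d f -> ford d (a *: f).
Proof. by move=> hf i j ij; rewrite coef2Z hf ?mulr0. Qed.

Lemma ford_sum d (I : Type) (r : seq I) (P : pred I) (F : I -> fps2 K) :
  (forall n, P n -> ford d (F n)) -> ford d (\sum_(n <- r | P n) F n).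
Proof. by move=> h i j ij; rewrite coef2_sum big1 // => n /h; exact. Qed.

Lemma fordX n t : ford 1 t -> ford n (t ^+ n).
Proof.
move=> ht; elim: n => [|n IH]; first exact: ford0.
by rewrite exprS -add1n; exact: fordM.
Qed.

Lemma hdegM d e f g : hdeg d f -> hdeg e g -> hdeg (d + e) (f * g).
Proof.
move=> hf hg i j ij; rewrite coef2M big1 // => k _; rewrite big1 // => l _.
have [ki lj] := (ltn_ord k, ltn_ord l).
have [kl|kl] := eqVneq (k + l)%N d; last by rewrite hf ?mul0r.
by rewrite [X in _ * X]hg ?mulr0 //; lia.
Qed.

Lemma hdeg1 : hdeg 0 (1 : fps2 K).
Proof. by move=> [|i] [|j]. Qed.

Lemma hdegX n t : hdeg 1 t -> hdeg n (t ^+ n).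
Proof.
move=> ht; elim: n => [|n IH]; first exact: hdeg1.
by rewrite exprS -add1n; exact: hdegM.
Qed.

Lemma hdegD d f g : hdeg d f -> hdeg d g -> hdeg d (f + g).
Proof. by move=> hf hg i j ij; rewrite coef2D hf ?hg ?addr0. Qed.

Lemma hdegN d f : hdeg d f -> hdeg d (- f).
Proof. by move=> hf i j ij; rewrite coef2N hf ?oppr0. Qed.

Lemma hdeg0 d : hdeg d (0 : fps2 K).
Proof. by []. Qed.

Lemma hdeg_lam : hdeg 1 (lam : fps2 K).
Proof. by move=> [|[|i]] [|[|j]]. Qed.

Lemma hdeg_mu : hdeg 1 (mu : fps2 K).
Proof. by move=> [|[|i]] [|[|j]]. Qed.

Lemma hdeg_ford d f : hdeg d f -> ford d f.
Proof. by move=> hf i j ij; apply: hf; rewrite neq_ltn ij. Qed.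

(** [fps_sum] cuts the series at the total degree of the coefficient. As [s n] starts in degree [n],
    any longer cut gives the same value, so one bound can serve many coefficients. *)
Lemma fps_sumE (s : nat -> fps2 K) N i j : (forall n, ford n (s n)) ->
  (i + j < N)%N -> coef2 (fps_sum s) i j = \sum_(n < N) coef2 (s n) i j.
Proof.
move=> hs ijN; rewrite /= (big_ord_widen N (fun n => coef2 (s n) i j) ijN).
rewrite [RHS](bigID (fun n : 'I_N => (n < (i + j).+1)%N)) /=.
by rewrite [X in _ + X]big1 ?addr0 // => n; rewrite -leqNgt => /hs.
Qed.

Lemma fps_sumM (s : nat -> fps2 K) g : (forall n, ford n (s n)) ->
  fps_sum s * g = fps_sum (fun n => s n * g).
Proof.
move=> hs; apply: coef2_inj => i j.
rewrite -[RHS]/(\sum_(n < (i + j).+1) coef2 (s n * g) i j).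
under [RHS]eq_bigr do rewrite coef2M.
rewrite exchange_big coef2M /=; apply: eq_bigr => k _.
rewrite exchange_big /=; apply: eq_bigr => l _.
rewrite -mulr_suml; congr (_ * _); apply: (fps_sumE hs).
by have := ltn_ord k; have := ltn_ord l; lia.
Qed.

Lemma eq_fps_sum (s s' : nat -> fps2 K) : s =1 s' -> fps_sum s = fps_sum s'.
Proof. by move=> e; congr fps_sum; exact/funext. Qed.

Lemma fps_sumD (s s' : nat -> fps2 K) :
  fps_sum s + fps_sum s' = fps_sum (fun n => s n + s' n).
Proof. by apply: coef2_inj => i j; rewrite coef2D /= -big_split. Qed.

Lemma fps_sumS (s : nat -> fps2 K) : (forall n, ford n (s n)) ->
  fps_sum s = s 0%N + fps_sum (fun n => s n.+1).
Proof.
move=> hs; apply: coef2_inj => i j.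
rewrite (@fps_sumE _ (i + j).+2) // big_ord_recl coef2D; congr (_ + _).
Qed.

(** The Euler operator [lambda d/dlambda + mu d/dmu]. *)
Definition euler f : fps2 K := Fps2 (fun i j => (i + j)%:R * coef2 f i j).

Lemma coef2_euler f i j : coef2 (euler f) i j = (i + j)%:R * coef2 f i j.
Proof. by []. Qed.

Lemma eulerD f g : euler (f + g) = euler f + euler g.
Proof. by apply: coef2_inj => i j; rewrite coef2D /= -mulrDr. Qed.

Lemma eulerN f : euler (- f) = - euler f.
Proof. by apply: coef2_inj => i j; rewrite coef2N /= -mulrN. Qed.

Lemma eulerB f g : euler (f - g) = euler f - euler g.
Proof. by rewrite eulerD eulerN. Qed.

Lemma eulerZ a f : euler (a *: f) = a *: euler f.
Proof. by apply: coef2_inj => i j /=; rewrite mulrCA. Qed.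

Lemma eulerM f g : euler (f * g) = euler f * g + f * euler g.
Proof.
apply: coef2_inj => i j; rewrite coef2D coef2_euler !coef2M mulr_sumr -big_split.
apply: eq_bigr => k _; rewrite /= mulr_sumr -big_split; apply: eq_bigr => l _.
rewrite /=.
have [ki lj] := (ltn_ord k, ltn_ord l).
have -> : (i + j = (k + l) + (i - k + (j - l)))%N by lia.
by rewrite natrD; ring.
Qed.

Lemma euler_hdeg d f : hdeg d f -> euler f = d%:R *: f.
Proof.
move=> hf; apply: coef2_inj => i j /=.
by have [->|/hf ->] := eqVneq (i + j)%N d; rewrite ?mulr0.
Qed.

Lemma euler1 : euler 1 = 0.
Proof. by rewrite (euler_hdeg hdeg1) scale0r. Qed.

Lemma eulerV v : hdeg 1 v -> euler v = v.
Proof. by move/euler_hdeg ->; rewrite scale1r. Qed.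

Lemma euler_fps_sum (s : nat -> fps2 K) :
  euler (fps_sum s) = fps_sum (fun n => euler (s n)).
Proof. by apply: coef2_inj => i j /=; rewrite mulr_sumr. Qed.

Lemma eulerX n t : euler (t ^+ n.+1) = n.+1%:R *: (euler t * t ^+ n).
Proof.
elim: n => [|n IH]; first by rewrite expr1 expr0 mulr1 scale1r.
rewrite exprS eulerM IH -[n.+2]addn1 natrD scalerDl scale1r addrC; congr (_ + _).
by rewrite -fps_scaleAr exprS; congr (_ *: _); ring.
Qed.

(** Uniqueness for a first order equation: in the lowest degree [N] where [d] could be nonzero it
    reads [N d = - n d], and [N + n] is invertible unless [N = 0], where the initial condition
    applies. *)
Lemma euler_eq0 d g : euler d = g * d -> coef2 d 0 0 = 0 ->
  (exists n, coef2 g 0 0 = - n%:R) -> d = 0.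
Proof.
move=> e d0 [n gn].
have H N : ford N d.
  elim: N => [|N IH] // i j ijN.
  have [ijN'|] := ltnP (i + j) N; first exact: IH.
  move=> Nij; have {ijN Nij} ijN : (i + j = N)%N by apply/eqP; rewrite eqn_leq Nij -ltnS ijN.
  have := congr1 (fun f => coef2 f i j) e.
  rewrite coef2_euler coef2M big_ord_recl big_ord_recl !subn0 gn big1 => [|l _]; last first.
    by rewrite IH ?mulr0 //= /bump /=; have := ltn_ord l; lia.
  rewrite big1 => [|k _]; last first.
    rewrite big1 // => l _; rewrite IH ?mulr0 //= /bump /=.
    by have := ltn_ord k; have := ltn_ord l; lia.
  rewrite !addr0 => /eqP; rewrite -subr_eq0 mulNr opprK -mulrDl -natrD mulf_eq0.
  case/orP => [|/eqP //]; rewrite pnatr_eq0 addn_eq0 => /andP[ij0 _].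
  by move: ij0; rewrite addn_eq0 => /andP[/eqP -> /eqP ->].
by apply: coef2_inj => i j; apply: (H (i + j).+1).
Qed.

End PowerSeriesTools.

(* Locked: unification must not compare two series by unfolding their
   coefficients. *)
HB.lock Definition ser (K : numFieldType) (c : nat -> K) (t : fps2 K) : fps2 K :=
  fps_sum (fun n => c n *: t ^+ n).

(** * One-variable series evaluated at a two-variable series: exponential and logarithm *)

Section Series.
Variable K : numFieldType.
Implicit Types (f g h t u v w : fps2 K) (c : nat -> K).

Lemma serE c t : ser c t = fps_sum (fun n => c n *: t ^+ n).
Proof. by rewrite unlock. Qed.

Lemma serS c t : ford 1 t -> ser c t = c 0%N *: (1 : fps2 K) + t * ser (fun n => c n.+1) t.
Proof.
move=> ht; rewrite !serE fps_sumS; last by move=> n; apply/fordZ/fordX.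
congr (_ + _); rewrite mulrC fps_sumM; last by move=> n; apply/fordZ/fordX.
by apply: eq_fps_sum => n; rewrite -fps_scaleAl exprSr.
Qed.

Lemma serD c c' t : ser c t + ser c' t = ser (fun n => c n + c' n) t.
Proof. by rewrite !serE fps_sumD; apply: eq_fps_sum => n; rewrite scalerDl. Qed.

Lemma eq_ser c c' t : c =1 c' -> ser c t = ser c' t.
Proof. by move=> e; rewrite !serE; apply: eq_fps_sum => n; rewrite e. Qed.

Lemma euler_ser c t : ford 1 t ->
  euler (ser c t) = euler t * ser (fun n => n.+1%:R * c n.+1) t.
Proof.
move=> ht; rewrite !serE fps_sumS; last by move=> n; apply/fordZ/fordX.
rewrite expr0 eulerD eulerZ euler1 scaler0 add0r euler_fps_sum mulrC fps_sumM; last first.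
  by move=> n; apply/fordZ/fordX.
apply: eq_fps_sum => n; rewrite eulerZ eulerX -fps_scaleAl scalerA mulrC.
by rewrite [euler t * _]mulrC.
Qed.

Lemma euler_serV c v : hdeg 1 v -> euler (ser c v) = ser (fun n => n%:R * c n) v.
Proof.
move=> hv; rewrite !serE euler_fps_sum; apply: eq_fps_sum => n.
by rewrite eulerZ (euler_hdeg (hdegX (n:=n) hv)) scalerA mulrC.
Qed.

Lemma coef00_ser c t : coef2 (ser c t) 0 0 = c 0%N.
Proof. by rewrite serE /= big_ord1 expr0 mulr1. Qed.

Lemma coef00M f g : coef2 (f * g) 0 0 = coef2 f 0 0 * coef2 g 0 0.
Proof. by rewrite coef2M !big_ord1. Qed.

(** [(e^t - 1) / t] *)
Definition expq t : fps2 K := ser (fun n => n.+1`!%:R^-1) t.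

Definition fexp t : fps2 K := ser (fun n => n`!%:R^-1) t.

Lemma fps_expE t : fps_exp t = fexp t.
Proof. by rewrite /fexp serE. Qed.

Lemma factSV n : n.+1%:R * n.+1`!%:R^-1 = n`!%:R^-1 :> K.
Proof.
by rewrite factS natrM invfM mulrA divff ?mul1r // pnatr_eq0.
Qed.

Lemma fexpq t : ford 1 t -> fexp t = 1 + t * expq t.
Proof. by move=> ht; rewrite /fexp serS // fact0 invr1 scale1r. Qed.

Lemma euler_exp t : ford 1 t -> euler (fexp t) = euler t * fexp t.
Proof.
move=> ht; rewrite /fexp euler_ser //; congr (_ * _).
by apply: eq_ser => n; exact: factSV.
Qed.

Lemma euler_expq v : hdeg 1 v -> euler (expq v) = fexp v - expq v.
Proof.
move=> hv; rewrite /expq /fexp euler_serV //; apply/eqP; rewrite eq_sym subr_eq serD.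
apply/eqP/eq_ser => n /=.
by rewrite -[X in _ + X]mul1r -mulrDl natr1 factSV.
Qed.

Lemma coef00_exp t : coef2 (fexp t) 0 0 = 1.
Proof. by rewrite /fexp coef00_ser fact0 invr1. Qed.

Lemma coef00_expq t : coef2 (expq t) 0 0 = 1.
Proof. by rewrite /expq coef00_ser invr1. Qed.

Lemma fexp0 : fexp (0 : fps2 K) = 1.
Proof. by rewrite fexpq // mul0r addr0. Qed.

Lemma expq0 : expq (0 : fps2 K) = 1.
Proof. by rewrite /expq serS // mul0r addr0 invr1 scale1r. Qed.

(** Both sides have constant term 1 and solve [euler d = (v + w) * d], so [euler_eq0] applies to
    their difference. *)
Lemma fexpD v w : hdeg 1 v -> hdeg 1 w ->
  fexp (v + w) = fexp v * fexp w.
Proof.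
move=> hv hw; have hvw := hdegD hv hw.
apply/eqP; rewrite -subr_eq0; apply/eqP.
apply: (@euler_eq0 _ _ (v + w)).
- rewrite eulerB eulerM !euler_exp ?eulerD ?eulerV //; do ?exact: hdeg_ford.
  by ring.
- by rewrite coef2D coef2N coef00M !coef00_exp mulr1 subrr.
- by exists 0%N; rewrite oppr0 hvw.
Qed.

(** Triangularity: in the lowest degree of [f], the product is [f] times the constant term of
    [g]. *)
Lemma unit_reg g f : coef2 g 0 0 != 0 -> g * f = 0 -> f = 0.
Proof.
move=> g0 e.
have H N : ford N f.
  elim: N => [|N IH] // i j ijN.
  have [ijN'|] := ltnP (i + j) N; first exact: IH.
  move=> Nij; have {ijN Nij} ijN : (i + j = N)%N by apply/eqP; rewrite eqn_leq Nij -ltnS ijN.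
  have := congr1 (fun f => coef2 f i j) e.
  rewrite coef2M big_ord_recl big_ord_recl !subn0 big1 => [|l _]; last first.
    by rewrite IH ?mulr0 //= /bump /=; have := ltn_ord l; lia.
  rewrite big1 => [|k _]; last first.
    rewrite big1 // => l _; rewrite IH ?mulr0 //= /bump /=.
    by have := ltn_ord k; have := ltn_ord l; lia.
  by rewrite !addr0 => /eqP; rewrite [_ == _]mulf_eq0 (negPf g0) => /eqP.
by apply: coef2_inj => i j; apply: (H (i + j).+1).
Qed.

(** This is [log (e^u) = u]. The Euler operator sends [log (1 + e)] to [u * fexp u] times the
    geometric series of [- e], which inverts [1 + e = fexp u]; so both sides have the same image. *)
Lemma log_exp u (e := fexp u - 1) : hdeg 1 u ->
  e * ser (fun n => (-1) ^+ n / n.+1%:R) e = u.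
Proof.
move=> hu; have hu1 := hdeg_ford hu.
have he : ford 1 e.
  by case=> [|i] [|j] // _; rewrite coef2D coef2N coef00_exp subrr.
(* The factor [e] is absorbed as an index shift; [euler_ser] then cancels the denominators and
   leaves only signs. *)
have -> : e * ser (fun n => (-1) ^+ n / n.+1%:R) e =
    ser (fun n => if n is n'.+1 then (-1) ^+ n' / n%:R else 0) e.
  by rewrite [RHS]serS // scale0r add0r.
set L := ser _ e; apply/eqP; rewrite -subr_eq0; apply/eqP.
apply: (@euler_eq0 _ _ 0).
- rewrite eulerB mul0r euler_ser // [euler u]eulerV //.
  rewrite [euler e]eulerB euler1 subr0 euler_exp // eulerV //.
  rewrite (_ : ser _ _ = ser (fun n => (-1) ^+ n) e); last first.
    by apply: eq_ser => n; rewrite mulrC divfK // pnatr_eq0.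
  have : fexp u * ser (fun n => (-1) ^+ n) e = 1.
    rewrite -[fexp u](subrK 1) -/e mulrDl mul1r {2}serS //.
    rewrite expr0 scale1r addrCA -[RHS]addr0; congr (_ + _).
    rewrite -mulrDr serD -[RHS](mulr0 e); congr (_ * _).
    apply: coef2_inj => i j; rewrite serE /= big1 // => n _.
    by rewrite exprS mulN1r subrr mul0r.
  by rewrite -mulrA => ->; rewrite mulr1 subrr.
- by rewrite coef2D coef2N coef00_ser add0r hu1 // oppr0.
- by exists 0%N; rewrite oppr0.
Qed.

End Series.

(** * Sums of Dynkin words *)

Lemma big_tupleS (V : nmodType) (T : finType) n (P : pred T) (F : seq T -> V) :
  \sum_(p : n.+1.-tuple T | all P p) F p =
  \sum_(q | P q) \sum_(p : n.-tuple T | all P p) F (q :: p).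
Proof.
rewrite pair_big_dep /=.
rewrite (reindex (fun qp : T * n.-tuple T => cons_tuple qp.1 qp.2)) /=.
  by apply: eq_bigl => -[q p].
exists (fun p => (thead p, behead_tuple p)) => [[q p] _ | p _] /=.
  by congr (_, _); apply: val_inj.
by rewrite [RHS]tuple_eta; apply: val_inj.
Qed.

Lemma big_tuple0 (V : nmodType) (T : finType) (P : pred T) (F : seq T -> V) :
  \sum_(p : 0.-tuple T | all P p) F p = F [::].
Proof.
by rewrite (big_pred1 [tuple]) // => p; rewrite (tuple0 p) /= eqxx.
Qed.

Section DynkinWords.
Variable K : numFieldType.
Implicit Types (f g h u : fps2 K).

(** Exponents in a Dynkin tuple are bounded, so finite sums over blocks match exponentials only in
    low degree; this is the congruence in which they are compared. *)
Definition eqf (d : nat) f g := forall i j, (i + j < d)%N -> coef2 f i j = coef2 g i j.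

Lemma eqfM d f f' g g' : eqf d f f' -> eqf d g g' -> eqf d (f * g) (f' * g').
Proof.
move=> hf hg i j ij; rewrite !coef2M; apply: eq_bigr => k _; apply: eq_bigr => l _.
have [ki lj] := (ltn_ord k, ltn_ord l).
by rewrite hf ?hg //; lia.
Qed.

Lemma eqfD d f f' g g' : eqf d f f' -> eqf d g g' -> eqf d (f + g) (f' + g').
Proof. by move=> hf hg i j ij; rewrite !coef2D hf ?hg. Qed.

Lemma eqfN d f f' : eqf d f f' -> eqf d (- f) (- f').
Proof. by move=> hf i j ij; rewrite !coef2N hf. Qed.

Lemma eqf_sum d (I : Type) (r : seq I) (P : pred I) (F F' : I -> fps2 K) :
  (forall n, P n -> eqf d (F n) (F' n)) ->
  eqf d (\sum_(n <- r | P n) F n) (\sum_(n <- r | P n) F' n).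
Proof.
by move=> h i j ij; rewrite !coef2_sum; apply: eq_bigr => n Pn; exact: h.
Qed.

Lemma eqf_trans d g f h : eqf d f g -> eqf d g h -> eqf d f h.
Proof. by move=> hf hg i j ij; rewrite hf ?hg. Qed.

Lemma eqfW d e f g : (d <= e)%N -> eqf e f g -> eqf d f g.
Proof. by move=> de h i j ij; apply: h; exact: leq_trans ij de. Qed.

Lemma eqf_ser d (c : nat -> K) u : ford 1 u -> eqf d (\sum_(n < d) c n *: u ^+ n) (ser c u).
Proof.
move=> hu i j ij; rewrite coef2_sum serE; apply/esym.
by apply: (@fps_sumE _ (fun n => c n *: u ^+ n)) => // n; apply/fordZ/fordX.
Qed.

Variables v w : fps2 K.
Hypotheses (hv : hdeg 1 v) (hw : hdeg 1 w).

(** In a metabelian Lie algebra, for [s] of length at least two,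
    [lbr] of the word [s] in [x] ([true]) and [y] ([false]) is
    [dyn s] applied to [[x, y]], where [v] and [w] act as [ad x] and [ad y]. *)
Fixpoint dyn (s : seq bool) : fps2 K :=
  if s is t :: s' then
    match s' with
    | [::] => 0
    | [:: l] => t%:R - l%:R
    | _ => (if t then v else w) * dyn s'
    end
  else 0.

Definition blk (q : nat * nat) : seq bool := nseq q.1 true ++ nseq q.2 false.

Definition cblk (q : nat * nat) : K := (q.1`! * q.2`!)%:R^-1.

Definition mon (q : nat * nat) : fps2 K := v ^+ q.1 * w ^+ q.2.

Lemma dyn_cons t s : (1 < size s)%N -> dyn (t :: s) = (if t then v else w) * dyn s.
Proof. by case: s => [|? []]. Qed.

Lemma dyn_ncat n t s : (1 < size s)%N ->
  dyn (nseq n t ++ s) = (if t then v else w) ^+ n * dyn s.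
Proof.
move=> hs; elim: n => [|n IH]; first by rewrite mul1r.
by rewrite exprS -mulrA -IH -dyn_cons // size_cat (leq_trans hs) // leq_addl.
Qed.

Lemma dyn_blk_cat q s : (1 < size s)%N -> dyn (blk q ++ s) = mon q * dyn s.
Proof.
move=> hs; rewrite -catA dyn_ncat; last by rewrite size_cat (leq_trans hs) // leq_addl.
by rewrite dyn_ncat // mulrA.
Qed.

Lemma dyn_nseq n t : dyn (nseq n t) = 0.
Proof.
case: n => [|[|n]] //.
rewrite -addn2 nseqD dyn_ncat // [dyn _]/= subrr mulr0 //.
Qed.

Lemma dyn_blk r s : dyn (blk (r, s)) = if (r, s) is (r'.+1, 1%N) then v ^+ r' else 0.
Proof.
case: r s => [|r] [|[|s]] //.
- by rewrite /blk /=; exact: (dyn_nseq s.+2 false).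
- by rewrite /blk cats0; exact: dyn_nseq.
- rewrite /blk [(_, _).1]/= -addn1 nseqD -catA dyn_ncat //.
  by rewrite [dyn _]/= subr0 mulr1.
- rewrite /blk [(_, _).2]/= -[s.+2]addn2 nseqD dyn_ncat ?size_cat ?addn2 //.
  by rewrite dyn_ncat // [dyn [:: _; _]]/= subrr !mulr0.
Qed.

Lemma dyn_blkT r s :
  dyn (blk (r, s) ++ [:: true]) = if s is s'.+1 then - (v ^+ r * w ^+ s') else 0.
Proof.
case: s => [|s].
  by rewrite /blk cats0 -[[:: true]]/(nseq 1 true) -nseqD dyn_nseq.
rewrite /blk -catA dyn_ncat ?size_cat ?addn1 // [(_, _).2]/= -addn1 nseqD -catA.
by rewrite dyn_ncat // [dyn _]/= sub0r !mulrN mulr1.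
Qed.

Lemma dyn_blkF r s :
  dyn (blk (r, s) ++ [:: false]) = if (r, s) is (r'.+1, 0%N) then v ^+ r' else 0.
Proof.
rewrite /blk -catA [(_, _).2]/= -[[:: false]]/(nseq 1 false) -nseqD addn1.
by rewrite -[_ ++ _]/(blk (r, s.+1)) dyn_blk.
Qed.

Lemma hdeg_dyn s : hdeg (size s - 2)%N (dyn s).
Proof.
elim: s => [|t [|l [|k s]] IH]; try exact: hdeg0.
  case: t l {IH} => -[]; rewrite /= ?subrr ?subr0 ?sub0r; try exact: hdeg0.
    exact: hdeg1.
  by apply: hdegN; exact: hdeg1.
have -> : (size [:: t, l, k & s] - 2 = 1 + (size [:: l, k & s] - 2))%N.
  by rewrite /= !subSS !subn0.
by rewrite dyn_cons //; apply: hdegM => //; case: t.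
Qed.

Variable M : nat.
Let T : finType := ('I_M.+1 * 'I_M.+1)%type.
Definition nzq (q : T) : bool := (0 < q.1 + q.2)%N.
Definition qval (q : T) : nat * nat := (val q.1, val q.2).

Definition dterm (p : seq T) : fps2 K :=
  (\prod_(q <- p) cblk (qval q)) *: dyn (flatten [seq blk (qval q) | q <- p]).

Definition dsum n : fps2 K := \sum_(p : n.-tuple T | all nzq p) dterm p.

Definition esum : fps2 K := \sum_(q : T | nzq q) cblk (qval q) *: mon (qval q).

Lemma size_flatten_nz (p : seq T) :
  all nzq p -> (size p <= size (flatten [seq blk (qval q) | q <- p]))%N.
Proof.
elim: p => //= q p IH /andP[q0 /IH h]; rewrite size_cat -add1n leq_add //.
by rewrite size_cat !size_nseq.
Qed.

(** At least two nonempty blocks follow the first one, so what follows is a word of length at least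
    two, on which the first block acts by its monomial. *)
Lemma dsumSS n : dsum n.+3 = esum * dsum n.+2.
Proof.
rewrite /dsum (big_tupleS _ nzq dterm).
rewrite mulr_suml; apply: eq_bigr => q _; rewrite mulr_sumr; apply: eq_bigr => p hp.
rewrite /dterm big_cons /= dyn_blk_cat; last first.
  by apply: leq_trans (size_flatten_nz hp); rewrite size_tuple.
by rewrite -scalerA -fps_scaleAl -fps_scaleAr.
Qed.

Lemma dsum1 : dsum 1 = \sum_(q : T | nzq q) cblk (qval q) *: dyn (blk (qval q)).
Proof.
rewrite /dsum (big_tupleS _ nzq dterm).
apply: eq_bigr => q _.
rewrite (big_tuple0 nzq (fun p => dterm (q :: p))).
by rewrite /dterm big_cons big_nil mulr1 /= cats0.
Qed.

Hypothesis M_gt0 : (0 < M)%N.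
Let i1 : 'I_M.+1 := Ordinal (M_gt0 : 1 < M.+1)%N.
Let i0 : 'I_M.+1 := ord0.

(** The recursion of [dsumSS] fails when the last block is a single letter: [dyn] of that letter is
    0, but prefixed by a block it need not be. The two extra sums account for a last letter [x] and
    a last letter [y]. *)
Lemma dsum2 : dsum 2 = esum * dsum 1 +
  \sum_(q : T | nzq q) cblk (qval q) *: dyn (blk (qval q) ++ [:: true]) +
  \sum_(q : T | nzq q) cblk (qval q) *: dyn (blk (qval q) ++ [:: false]).
Proof.
rewrite [LHS](big_tupleS _ nzq dterm).
rewrite mulr_suml -!big_split; apply: eq_bigr => q _ /=.
rewrite (big_tupleS _ nzq (fun p => dterm (q :: p))).
transitivity (\sum_(q' : T | nzq q') (cblk (qval q) * cblk (qval q')) *: dyn (blk (qval q) ++ blk (qval q'))).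
  apply: eq_bigr => q' _.
  rewrite (big_tuple0 nzq (fun p => dterm [:: q, q' & p])).
  by rewrite /dterm !big_cons big_nil mulr1 /= cats0.
rewrite dsum1 mulr_sumr.
(* Split off the one-letter last blocks; every other last block has length at least two. *)
rewrite (bigD1 (i1, i0)) //= (bigD1 (i0, i1)) //=.
rewrite [X in _ = X + _ + _](bigD1 (i1, i0)) //= [X in _ = _ + X + _ + _](bigD1 (i0, i1)) //=.
rewrite /qval /= -[cblk (1, 0)%N]/(1%:R^-1) -[cblk (0, 1)%N]/(1%:R^-1) invr1 mulr1.
rewrite !scaler0 !mulr0 !add0r addrA [LHS]addrC -addrA; congr (_ + _).
apply: eq_bigr => -[[r hr] [s hs]] /andP[/andP[nz n1] n2].
rewrite dyn_blk_cat; first by rewrite -scalerA -fps_scaleAl -fps_scaleAr.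
move: nz n1 n2; rewrite /nzq !xpair_eqE -!val_eqE /= size_cat !size_nseq.
by move=> /=; lia.
Qed.

Lemma sum_pair (F : nat -> nat -> fps2 K) :
  \sum_(q : T | nzq q) F q.1 q.2 =
  \sum_(r < M.+1) \sum_(s < M.+1) F r s - F 0%N 0%N.
Proof.
rewrite pair_bigA /= [in RHS](bigD1 (ord0, ord0)) //= addrAC subrr add0r.
apply: eq_bigl => -[[r hr] [s hs]].
by rewrite /nzq !xpair_eqE -!val_eqE /=; lia.
Qed.

Let e := fexp (v + w) - 1.

Lemma esumE : eqf M esum e.
Proof.
rewrite /esum (sum_pair (fun r s => cblk (r, s) *: mon (r, s))).
apply: eqfD; last first.
  by rewrite /mon mulr1 /cblk /= invr1 scale1r.
have -> : \sum_(r < M.+1) \sum_(s < M.+1) cblk ((r : nat), (s : nat)) *: mon ((r : nat), (s : nat)) =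
    (\sum_(r < M.+1) r`!%:R^-1 *: v ^+ r) * (\sum_(s < M.+1) s`!%:R^-1 *: w ^+ s).
  rewrite mulr_suml; apply: eq_bigr => r _; rewrite mulr_sumr; apply: eq_bigr => s _.
  by rewrite -fps_scaleAl -fps_scaleAr scalerA -invfM -natrM.
rewrite fexpD //; apply: eqfM; apply: (@eqfW _ M.+1) => //;
  rewrite /fexp; apply: (@eqf_ser _ (fun n => n`!%:R^-1)); exact: hdeg_ford.
Qed.

(** Among single blocks only [x^(r+1) y] has a nonzero bracket, namely [v^r], with weight
    [1 / (r+1)!]. *)
Lemma dsum1E : eqf M (dsum 1) (expq v).
Proof.
rewrite dsum1 (sum_pair (fun r s => cblk (r, s) *: dyn (blk (r, s)))).
rewrite (dyn_blk 0 0) scaler0 subr0 big_ord_recl [X in X + _]big1 ?add0r => [|s _]; last first.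
  by rewrite dyn_blk /= scaler0.
apply: eqf_trans (@eqf_ser _ (fun n => n.+1`!%:R^-1) _ (hdeg_ford hv)).
apply: eqf_sum => r _; rewrite (bigD1 i1) // big1 ?addr0 => [|s]; last first.
  by rewrite -val_eqE lift0 dyn_blk; case: s => -[|[|s]] hs //= _; rewrite scaler0.
by rewrite lift0 dyn_blk /cblk /= muln1 addr0.
Qed.

(** The word [x^r y^(s+1) x] contributes [- v^r w^s], and the double sum of the weights factors. *)
Lemma dsumTE : eqf M
  (\sum_(q : T | nzq q) cblk (qval q) *: dyn (blk (qval q) ++ [:: true]))
  (- (fexp v * expq w)).
Proof.
rewrite (sum_pair (fun r s => cblk (r, s) *: dyn (blk (r, s) ++ [:: true]))).
rewrite (dyn_blkT 0 0) scaler0 subr0.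
have -> : \sum_(r < M.+1) \sum_(s < M.+1)
     cblk ((r : nat), (s : nat)) *: dyn (blk ((r : nat), (s : nat)) ++ [:: true]) =
   - ((\sum_(r < M.+1) r`!%:R^-1 *: v ^+ r) * (\sum_(s < M) s.+1`!%:R^-1 *: w ^+ s)).
  rewrite mulr_suml -sumrN; apply: eq_bigr => r _; rewrite mulr_sumr.
  rewrite big_ord_recl dyn_blkT scaler0 add0r -sumrN; apply: eq_bigr => s _.
  rewrite dyn_blkT /= scalerN -fps_scaleAl -fps_scaleAr scalerA -invfM -natrM.
  by [].
apply/eqfN/eqfM; last exact: (@eqf_ser _ (fun n => n.+1`!%:R^-1) _ (hdeg_ford hw)).
apply: (@eqfW _ M.+1) => //; rewrite /fexp.
exact: (@eqf_ser _ (fun n => n`!%:R^-1) _ (hdeg_ford hv)).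
Qed.

Lemma dsumFE : eqf M
  (\sum_(q : T | nzq q) cblk (qval q) *: dyn (blk (qval q) ++ [:: false])) (expq v).
Proof.
rewrite (sum_pair (fun r s => cblk (r, s) *: dyn (blk (r, s) ++ [:: false]))).
rewrite (dyn_blkF 0 0) scaler0 subr0 big_ord_recl [X in X + _]big1 ?add0r => [|s _]; last first.
  by rewrite dyn_blkF /= scaler0.
apply: eqf_trans (@eqf_ser _ (fun n => n.+1`!%:R^-1) _ (hdeg_ford hv)).
apply: eqf_sum => r _; rewrite big_ord_recl big1 ?addr0 => [|s _]; last first.
  by rewrite dyn_blkF /= scaler0.
by rewrite dyn_blkF /cblk /= muln1.
Qed.

(** Each additional leading block multiplies by [e]; the second summand is the one-letter correction
    of [dsum2], which first appears with two blocks. *)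
Lemma dsumE n : eqf M (dsum n.+1) (e ^+ n * expq v +
  if n is n'.+1 then e ^+ n' * (expq v - fexp v * expq w) else 0).
Proof.
elim: n => [|[|n] IH].
- by rewrite mul1r addr0; exact: dsum1E.
- rewrite dsum2 expr1 mul1r [expq v - _]addrC addrA.
  apply: eqfD dsumFE; apply: eqfD dsumTE; apply: eqfM esumE dsum1E.
rewrite dsumSS (exprS _ n.+1) (exprS e n) -!mulrA -mulrDr.
by apply: eqfM esumE _; move: IH; rewrite exprS -mulrA.
Qed.

End DynkinWords.

(** * The Campbell-Baker-Hausdorff series of a metabelian Lie algebra *)

(** The left side is [euler (e * h - J)] once the derivatives of [e], [h] and [J] are substituted;
    the identity exhibits it as a multiple of [e * h - J]. *)
Lemma cbh_ode_identity (R : comNzRingType) (u v w e La La2 J h qv qw ev ew : R) :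
    u = v + w -> e = ev * ew - 1 -> ev = 1 + v * qv -> ew = 1 + w * qw ->
    e * La = u -> La = 1 + e * La2 -> J = ev * qw - qv ->
  u * (e + 1) * h + e * (La * qv - La2 * J - h *+ 2)
    - (v * ev * qw + ev * (ew - qw) - (ev - qv))
  = (La + u - 2%:R) * (e * h - J).
Proof.
move=> uE eE evE ewE eLa LaE JE.
have -> : e * (La * qv - La2 * J - h *+ 2) = u * qv - (La - 1) * J - e * h *+ 2.
  by rewrite [X in X - 1]LaE -eLa; ring.
have -> : u * (e + 1) * h = La * e * h + u * e * h by rewrite -eLa; ring.
by rewrite JE uE ewE; ring.
Qed.

(** The factor [v + w] turns [qu] into [e^(v+w) - 1], whose product with [h] is known. *)
Lemma cbh_quotient_identity (R : comNzRingType) (v w h qu qv qw ev ew : R) :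
    ev * ew = 1 + (v + w) * qu -> ev = 1 + v * qv -> ew = 1 + w * qw ->
    (ev * ew - 1) * h = ev * qw - qv ->
  (v + w) * (qu * (v * h) - (ev * qw - qu)) = 0 /\
  (v + w) * (qu * (w * h) - (qu - qv)) = 0.
Proof.
move=> quE qvE qwE hE.
have {}quE : (v + w) * qu = ev * ew - 1 by rewrite quE; ring.
split.
  transitivity (v * ((v + w) * qu * h) - (v + w) * ev * qw + (v + w) * qu).
    by ring.
  by rewrite quE hE qwE qvE; ring.
transitivity (w * ((v + w) * qu * h) - (v + w) * qu + (v + w) * qv); first by ring.
by rewrite quE hE qwE qvE; ring.
Qed.

Section CbhSeries.
Variable K : numFieldType.
Variables v w : fps2 K.
Hypotheses (hv : hdeg 1 v) (hw : hdeg 1 w).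

(** Mirrors [cbh_part], with [dyn] of a boolean word in place of the iterated bracket. *)
Definition cbh_part_series (m : nat) : fps2 K :=
  \sum_(1 <= n < m.+1)
    \sum_(p : n.-tuple ('I_m.+1 * 'I_m.+1) |
            all (fun q => 0 < nat_of_ord q.1 + nat_of_ord q.2)%N p &&
            (\sum_(q <- p) (nat_of_ord q.1 + nat_of_ord q.2) == m)%N)
      ((-1) ^+ n.-1 / (n * m * \prod_(q <- p) ((nat_of_ord q.1)`! * (nat_of_ord q.2)`!))%N%:R) *:
        dyn v w (flatten [seq nseq (nat_of_ord q.1) true ++ nseq (nat_of_ord q.2) false | q <- p]).

(** [cbh x y = x + y + cbh_series [x, y]] when [v] and [w] act as [ad x] and
    [ad y]. *)
Definition cbh_series : fps2 K :=
  Fps2 (fun i j => coef2 (cbh_part_series (i + j).+2) i j).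

Lemma coef2_dyn s i j : size s != (i + j).+2 -> coef2 (dyn v w s) i j = 0.
Proof.
case: s => [|t [|l s]] // hs; apply: (hdeg_dyn hv hw).
by move: hs; rewrite /= !subSS subn0 !eqSS eq_sym.
Qed.

Lemma size_word m n (p : n.-tuple ('I_m.+1 * 'I_m.+1)) :
  size (flatten [seq nseq (nat_of_ord q.1) true ++ nseq (nat_of_ord q.2) false | q <- p])
  = (\sum_(q <- p) (nat_of_ord q.1 + nat_of_ord q.2))%N.
Proof.
rewrite size_flatten /shape -map_comp sumnE big_map.
by apply: eq_bigr => q _; rewrite /= size_cat !size_nseq.
Qed.

Lemma coef2_cbh_part_series m i j : m != (i + j).+2 ->
  coef2 (cbh_part_series m) i j = 0.
Proof.
move=> hm; rewrite coef2_sum big1 // => n _; rewrite coef2_sum big1 // => p.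
move=> /andP[_ /eqP pm].
by rewrite coef2Z coef2_dyn ?mulr0 // size_word pm.
Qed.

Lemma cbh_part_seriesE i j (m := (i + j).+2) :
  m%:R * coef2 (cbh_part_series m) i j =
  \sum_(n < m) (-1) ^+ n / n.+1%:R * coef2 (dsum v w m n.+1) i j.
Proof.
rewrite /cbh_part_series big_add1 /= big_mkord coef2_sum mulr_sumr.
apply: eq_bigr => n _; rewrite !coef2_sum big_mkcondr /= !mulr_sumr.
apply: eq_big => // p _; case: eqP => [pm|/eqP pm]; last first.
  by rewrite coef2_dyn ?mulr0 // size_word.
rewrite !mulrA; congr (_ * _).
have -> : \prod_(q <- p) cblk K (qval q) =
    (\prod_(q <- p) ((nat_of_ord q.1)`! * (nat_of_ord q.2)`!))%N%:R^-1.
  by rewrite natr_prod -prodfV.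
have m0 : m%:R != 0 :> K by rewrite pnatr_eq0.
rewrite !natrM !invfM !mulrA; congr (_ * _).
by rewrite -[m%:R * _ / _]mulrA [LHS]mulrC mulKf.
Qed.

Let u := v + w.
Let e := fexp u - 1.
Let J := fexp v * expq w - expq v.
Let La := ser (fun n => (-1) ^+ n / n.+1%:R) e.
Let La2 := ser (fun n => (-1) ^+ n.+1 / n.+2%:R) e.

Let hu : hdeg 1 u. Proof. exact: hdegD. Qed.
Let he : ford 1 e.
Proof. by case=> [|i] [|j] // _; rewrite coef2D coef2N coef00_exp subrr. Qed.

(** A word of length [m] gives a series of degree [m - 2], so [euler + 2] multiplies by the word
    length. What remains is the logarithm series applied to the closed forms of [dsumE]. *)
Lemma euler_cbh_series :
  euler cbh_series + 2%:R *: cbh_series = La * expq v - La2 * J.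
Proof.
apply: coef2_inj => i j; set m := (i + j).+2.
rewrite coef2D coef2Z coef2_euler -mulrDl -natrD addn2 -/m.
rewrite -[coef2 cbh_series i j]/(coef2 (cbh_part_series m) i j) cbh_part_seriesE.
pose R := (\sum_(n < m) ((-1) ^+ n / n.+1%:R) *: e ^+ n) * expq v -
  (\sum_(n < m.-1) ((-1) ^+ n.+1 / n.+2%:R) *: e ^+ n) * J.
transitivity (coef2 R i j); last first.
  suff H : eqf m.-1 R (La * expq v - La2 * J) by exact: H.
  apply: eqfD; last apply: eqfN; apply: eqfM => //.
    apply: (@eqfW _ _ m) => //.
    exact: (@eqf_ser _ _ (fun n => (-1) ^+ n / n.+1%:R)).
  exact: (@eqf_ser _ _ (fun n => (-1) ^+ n.+1 / n.+2%:R)).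
have -> : R = \sum_(n < m) ((-1) ^+ n / n.+1%:R) *: (e ^+ n * expq v +
    if val n is n'.+1 then e ^+ n' * (expq v - fexp v * expq w) else 0).
  rewrite /R; under [RHS]eq_bigr do rewrite scalerDr.
  rewrite big_split /= mulr_suml; congr (_ + _).
    by apply: eq_bigr => n _; rewrite fps_scaleAl.
  rewrite mulr_suml -sumrN [RHS]big_ord_recl scaler0 add0r.
  apply: eq_bigr => n _.
  by rewrite -fps_scaleAl lift0 -scalerN -mulrN opprB.
rewrite coef2_sum; apply: eq_bigr => n _; rewrite coef2Z; congr (_ * _).
by apply: (dsumE hv hw) => //; rewrite ltnS leqnSn.
Qed.

Let LaE : La = 1 + e * La2.
Proof. by rewrite /La serS // expr0 invr1 mulr1 scale1r. Qed.

(** The difference of the two sides solves a homogeneous first order equation, by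
    [cbh_ode_identity], and has constant term 0; [euler_eq0] makes it vanish. *)
Lemma cbh_series_eq : (fexp u - 1) * cbh_series = J.
Proof.
have eLa : e * La = u := log_exp hu.
have H := euler_cbh_series.
have eE : euler e = u * (e + 1).
  by rewrite eulerB euler1 subr0 (euler_exp (hdeg_ford hu)) (eulerV hu) subrK.
have vw : fexp u = fexp v * fexp w := fexpD hv hw.
have Ev : fexp v = 1 + v * expq v := fexpq (hdeg_ford hv).
have Ew : fexp w = 1 + w * expq w := fexpq (hdeg_ford hw).
have EJ : euler J = v * fexp v * expq w + fexp v * (fexp w - expq w) -
    (fexp v - expq v).
  rewrite eulerB; congr (_ - _); last exact: euler_expq.
  rewrite eulerM; congr (_ * _ + _ * _); last exact: euler_expq.
  rewrite (euler_exp (hdeg_ford hv)) (eulerV hv); reflexivity.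
set h := cbh_series in H *.
apply/eqP; rewrite -subr_eq0; apply/eqP; rewrite -/e.
apply: (@euler_eq0 _ _ (La + u - 2%:R)).
- rewrite eulerB eulerM eE EJ.
  have -> : euler h = La * expq v - La2 * J - 2%:R *: h by rewrite -H addrK.
  rewrite scaler_nat.
  by apply: cbh_ode_identity Ev Ew eLa LaE _; rewrite // -vw.
- have e00 : coef2 e 0 0 = 0 by exact: he.
  rewrite coef2D coef2N coef00M e00 mul0r sub0r coef2D coef2N coef00M.
  rewrite (coef00_exp v) (coef00_expq w) (coef00_expq v) mulr1 subrr oppr0.
  reflexivity.
(* [La] has constant term 1 and [u] has none, so [La + u - 2] has constant term -1. *)
- exists 1%N; rewrite !coef2D coef2N -[2%:R]/(1 + 1 : fps2 K) coef2D coef2_1.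
  by rewrite coef00_ser hv // hw // !addr0 expr0 divr1 opprD addrA subrr sub0r.
Qed.

Hypothesis u_reg : forall f, u * f = 0 -> f = 0.

Let quotients :
  u * (expq u * (v * cbh_series) - (fexp v * expq w - expq u)) = 0 /\
  u * (expq u * (w * cbh_series) - (expq u - expq v)) = 0.
Proof.
apply: (@cbh_quotient_identity _ _ _ _ _ _ _ _ (fexp w)).
- rewrite -(fexpD hv hw); apply: fexpq; exact: hdeg_ford.
- by apply: fexpq; exact: hdeg_ford.
- by apply: fexpq; exact: hdeg_ford.
- rewrite -(fexpD hv hw); exact: cbh_series_eq.
Qed.

Lemma cbh_series_l : expq u * (v * cbh_series) = fexp v * expq w - expq u.
Proof. by apply/subr0_eq/u_reg; case: quotients. Qed.

Lemma cbh_series_r : expq u * (w * cbh_series) = expq u - expq v.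
Proof. by apply/subr0_eq/u_reg; case: quotients. Qed.

End CbhSeries.

(** * Completions of metabelian Lie algebras *)

Section Metabelian.
Variables (K : fieldType) (L : lieAlgType K).
Implicit Types x y z t : L.

Definition metabelian := forall x y z t, lie (lie x y) (lie z t) = 0.

Lemma lie_deriv x y z : lie x (lie y z) = lie (lie x y) z + lie y (lie x z).
Proof.
have /eqP := lie_jacobi x y z; rewrite -addrA addr_eq0 => /eqP ->.
by rewrite opprD addrC [lie (lie x y) z]lie_anti [lie z x]lie_anti liexN opprK.
Qed.

Lemma metab_lieCA x y z t : metabelian ->
  lie x (lie y (lie z t)) = lie y (lie x (lie z t)).
Proof. by move=> h; rewrite lie_deriv h add0r. Qed.

End Metabelian.

Section Hat.
Variables (K : numFieldType) (L : lieAlgType K) (G : set L).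
Notation Lhat := (completion G).
Implicit Types x y z : Lhat.

Lemma hcompD x y d : hcomp (x + y) d = hcomp x d + hcomp y d.
Proof. by []. Qed.

Lemma hcomp_lie x y d :
  hcomp (lie x y) d = \sum_(i < d.+1) lie (hcomp x i) (hcomp y (d - i)).
Proof. by []. Qed.

Lemma metab_hat : metabelian L -> metabelian Lhat.
Proof.
move=> h x y z t; apply: hcomp_inj => d; rewrite hcomp_lie big1 // => i _.
rewrite !hcomp_lie lie_suml big1 // => j _; rewrite lie_sumr big1 // => k _; exact: h.
Qed.

Lemma csumD (s s' : nat -> Lhat) : csum (fun m => s m + s' m) = csum s + csum s'.
Proof. by apply: hcomp_inj => d; rewrite /= -big_split. Qed.

Lemma eq_csum (s s' : nat -> Lhat) : s =1 s' -> csum s = csum s'.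
Proof. by move=> e; congr csum; exact/funext. Qed.

Lemma csum1 z : csum (fun m => if m == 1%N then z else 0) = z.
Proof.
apply: hcomp_inj => -[|d] /=; first by rewrite big_ord1 !hcomp0.
by rewrite big_ord_recl add0r big_ord_recl big1 ?addr0.
Qed.

Lemma cbh_part0 x y : cbh_part x y 0 = 0.
Proof. by rewrite /cbh_part big_geq. Qed.

Lemma cbh_part1 x y : cbh_part x y 1 = x + y.
Proof.
rewrite /cbh_part big_nat1.
pose o : 'I_2 := ord0; pose i : 'I_2 := ord_max.
rewrite (bigD1 [tuple (i, o)]) /=; last by rewrite big_seq1.
rewrite (bigD1 [tuple (o, i)]) /=; last by rewrite big_seq1.
rewrite !big_seq1 big1 /= ?addr0 => [|p].
  by rewrite expr0 divr1 !scale1r.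
case/tupleP: p => -[r s] p; rewrite (tuple0 p) -!val_eqE /= big_seq1 /=.
rewrite !eqseq_cons !xpair_eqE -!val_eqE /= !andbT.
by case: r s => [[|[|r]] hr] [[|[|s]] hs].
Qed.

Let word x y (s : seq bool) := lbr [seq if t then x else y | t <- s].

Lemma lbr_cons x y (s : seq Lhat) : lbr [:: x, y & s] = lie x (lbr (y :: s)).
Proof. by []. Qed.

Lemma cbh_wordE x y m (p : seq ('I_m.+1 * 'I_m.+1)) :
  flatten [seq nseq (nat_of_ord q.1) x ++ nseq (nat_of_ord q.2) y | q <- p] =
  [seq if t then x else y | t <-
    flatten [seq nseq (nat_of_ord q.1) true ++ nseq (nat_of_ord q.2) false | q <- p]].
Proof.
rewrite map_flatten -map_comp; congr flatten; apply: eq_map => q /=.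
by rewrite map_cat !map_nseq.
Qed.

Lemma cbh_comm x y : lie x y = 0 -> cbh x y = x + y.
Proof.
move=> xy0.
have W s : (1 < size s)%N -> word x y s = 0.
  elim: s => [|t [|l [|k s]] IH] // _.
    by case: t l {IH} => -[]; rewrite /word /= ?liexx // lie_anti xy0 oppr0.
  by rewrite /word lbr_cons -[lbr _]/(word x y [:: l, k & s]) IH // liex0.
rewrite -[RHS]csum1; apply: eq_csum => -[|[|m]]; rewrite ?cbh_part0 ?cbh_part1 //.
rewrite [LHS]big1 // => n _; rewrite big1 // => p /andP[_ /eqP pm].
by rewrite cbh_wordE -[lbr _]/(word x y _) W ?scaler0 // size_word pm.
Qed.

Lemma br_wordE k l x y : br_word k l x y = iter k (lie x) (iter l (lie y) (lie x y)).
Proof.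
have H n z (s : seq Lhat) : (0 < size s)%N -> lbr (nseq n z ++ s) = iter n (lie z) (lbr s).
  move=> hs; elim: n => //= n <-.
  by case: (nseq n z ++ s) (size_cat (nseq n z) s) => //; case: s hs => //= ? ? _; rewrite addnS.
by rewrite /br_word !H // size_cat addn2.
Qed.

Hypothesis metabL : metabelian L.
Variables X Y : L.
Hypotheses (hX : homog G 1 X) (hY : homog G 1 Y).

Definition adm k l : L := iter k (lie Y) (iter l (lie X) (lie X Y)).

Lemma homog_adm k l : homog G (k + l).+2 (adm k l).
Proof.
rewrite /adm; elim: k => [|k IH] /=; last first.
  by rewrite -[X in homog _ X]/(1 + (k + l).+2)%N; exact: homog_lie.
elim: l => [|l IH] /=; first exact: (@homog_lie _ _ _ 1 1).
by rewrite -[X in homog _ X]/(1 + l.+2)%N; exact: homog_lie.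
Qed.

Lemma adm_lie k l : exists u v, adm k l = lie u v.
Proof.
case: k => [|k]; last by rewrite /adm iterS; do 2!eexists.
case: l => [|l]; first by exists X, Y.
by rewrite /adm /=; do 2!eexists.
Qed.

Lemma lieY_adm k l : lie Y (adm k l) = adm k.+1 l.
Proof. by []. Qed.

(** [ad X] moves past every [ad Y], because adjoint operators commute on the derived algebra. *)
Lemma lieX_adm k l : lie X (adm k l) = adm k l.+1.
Proof.
elim: k => [|k IH] //; rewrite -[adm k.+1 l]lieY_adm -[adm k.+1 l.+1]lieY_adm -IH.
by have [u [v ->]] := adm_lie k l; exact: metab_lieCA.
Qed.

(** [[X, Y]] has degree two, so the part of [f] of degree [e] lands in degree [e + 2]. *)
Definition omega_comp (f : fps2 K) (d : nat) : L :=
  if d is e.+2 then \sum_(k < e.+1) coef2 f k (e - k)%N *: adm k (e - k)%N else 0.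

Lemma omega_subproof f d : homog G d (omega_comp f d).
Proof.
case: d => [|[|e]]; [exact: homog0 | exact: homog0|].
apply: homog_sum => k _; apply: homogZ; rewrite -{1}(subnKC (ltn_ord k : k <= e)%N).
exact: homog_adm.
Qed.

(** [f(ad Y, ad X) [X, Y]] *)
Definition omega f : Lhat := Completion _ (omega_subproof f).

Lemma hcomp_omega f e : hcomp (omega f) e.+2 =
  \sum_(k < e.+1) coef2 f k (e - k)%N *: adm k (e - k)%N.
Proof. by []. Qed.

Lemma hcomp_omega1 f : hcomp (omega f) 1 = 0. Proof. by []. Qed.

Lemma omegaD f g : omega (f + g) = omega f + omega g.
Proof.
apply: hcomp_inj => -[|[|e]]; rewrite hcompD /= ?addr0 // -big_split.
by apply: eq_bigr => k _; rewrite /= -scalerDl.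
Qed.

Lemma omegaZ a f : omega (a *: f) = a *: omega f.
Proof.
apply: hcomp_inj => -[|[|e]]; rewrite -[RHS]/(a *: omega_comp f _) /= ?scaler0 //.
by rewrite scaler_sumr; apply: eq_bigr => k _; rewrite scalerA.
Qed.

Lemma omegaN f : omega (- f) = - omega f.
Proof. by rewrite -scaleN1r omegaZ scaleN1r. Qed.

Lemma omega0 : omega 0 = 0.
Proof. by rewrite -(scale0r 0) omegaZ scale0r. Qed.

Lemma omega_sum (I : Type) (r : seq I) (P : pred I) (F : I -> fps2 K) :
  omega (\sum_(n <- r | P n) F n) = \sum_(n <- r | P n) omega (F n).
Proof. exact: (big_morph omega omegaD omega0). Qed.

Definition deg1 (z : Lhat) (Z : L) := forall d, hcomp z d = if d == 1%N then Z else 0.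

Lemma hcomp_lie1 z Z y d : deg1 z Z -> hcomp (lie z y) d.+1 = lie Z (hcomp y d).
Proof.
move=> hz; rewrite hcomp_lie big_ord_recl hz lie0x add0r big_ord_recl hz /=.
by rewrite big1 ?addr0 ?subn1 // => i _; rewrite hz lie0x.
Qed.

Lemma lie_omega_lam z f : deg1 z Y -> lie z (omega f) = omega (lam * f).
Proof.
move=> hz; apply: hcomp_inj => -[|d]; first by rewrite !hcomp0.
rewrite (hcomp_lie1 _ _ hz); case: d => [|[|e]].
- by rewrite hcomp0 hcomp_omega1 liex0.
- by rewrite hcomp_omega1 hcomp_omega liex0 big_ord1 coef2_lamM scale0r.
rewrite !hcomp_omega lie_sumr [RHS]big_ord_recl coef2_lamM scale0r add0r.
by apply: eq_bigr => k _; rewrite lieZr lieY_adm lift0 coef2_lamM subSS.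
Qed.

Lemma lie_omega_mu z f : deg1 z X -> lie z (omega f) = omega (mu * f).
Proof.
move=> hz; apply: hcomp_inj => -[|d]; first by rewrite !hcomp0.
rewrite (hcomp_lie1 _ _ hz); case: d => [|[|e]].
- by rewrite hcomp0 hcomp_omega1 liex0.
- by rewrite hcomp_omega1 hcomp_omega liex0 big_ord1 coef2_muM scale0r.
rewrite !hcomp_omega lie_sumr [RHS]big_ord_recr subnn coef2_muM scale0r Monoid.mulm1.
apply: eq_bigr => k _; rewrite lieZr lieX_adm coef2_muM subSn //.
by have := ltn_ord k; rewrite ltnS.
Qed.

Lemma lie_omega2 f g : lie (omega f) (omega g) = 0.
Proof.
apply: hcomp_inj => d; rewrite hcomp_lie big1 // => i _.
case: (nat_of_ord i) => [|[|e]]; rewrite ?lie0x // /=.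
case: (d - _)%N => [|[|e']]; rewrite ?liex0 //= lie_suml big1 // => k _.
rewrite lie_sumr big1 // => l _; rewrite lieZl lieZr.
have [u [v ->]] := adm_lie k (e - k); have [u' [v' ->]] := adm_lie l (e' - l).
by rewrite metabL !scaler0.
Qed.

Lemma lie_omega1 x y : deg1 x X -> deg1 y Y -> lie x y = omega 1.
Proof.
move=> hx hy; apply: hcomp_inj => -[|d]; first by rewrite !hcomp0.
rewrite (hcomp_lie1 _ _ hx) hy; case: d => [|[|e]].
- by rewrite hcomp_omega1 liex0.
- by rewrite hcomp_omega big_ord1 coef2_1 scale1r.
rewrite liex0 hcomp_omega big1 // => -[[|k] hk] _; rewrite coef2_1 ?subn0.
  by rewrite scale0r.
by rewrite scale0r.
Qed.

(** Coefficients of degree [i + j] live in degree [i + j + 2] of the completion, where [csum]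
    collects the terms up to index [i + j + 2]; hence the bound. *)
Lemma csum_omega (s : nat -> fps2 K) g :
  (forall i j, coef2 g i j = \sum_(m < (i + j).+3) coef2 (s m) i j) ->
  csum (fun m => omega (s m)) = omega g.
Proof.
move=> h; apply: hcomp_inj => -[|[|e]] /=; try by rewrite big1.
rewrite exchange_big; apply: eq_bigr => k _ /=.
by rewrite h scaler_suml subnKC // -ltnS.
Qed.

Section Cbh.
Variables (v w k : fps2 K) (x y : Lhat).
Hypotheses (hv : hdeg 1 v) (hw : hdeg 1 w).
Hypothesis lie_x : forall f, lie x (omega f) = omega (v * f).
Hypothesis lie_y : forall f, lie y (omega f) = omega (w * f).
Hypothesis lie_xy : lie x y = omega k.

Lemma lbr_dyn s : (1 < size s)%N -> word x y s = omega (dyn v w s * k).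
Proof.
elim: s => [|t [|l [|r s]] IH] // _.
  case: t l {IH} => -[]; rewrite /word /= ?liexx ?subrr ?mul0r ?omega0 //.
    by rewrite subr0 mul1r.
  by rewrite sub0r mulN1r omegaN lie_anti lie_xy.
rewrite /word map_cons lbr_cons -[lbr _]/(word x y [:: l, r & s]) IH //.
by rewrite [in RHS]dyn_cons // -mulrA; case: t.
Qed.

(** All brackets of words are computed by [lbr_dyn] from the actions of [x] and [y] on derived
    elements and from [[x, y]] alone. Hence [x] and [y] may be generators, derived elements, or sums
    of both, as the successive products of the hexagon require. *)
Lemma cbh_omega : cbh x y = x + y + omega (cbh_series v w * k).
Proof.
rewrite -(csum1 (x + y)) -(@csum_omega (fun m => cbh_part_series v w m * k)).
  rewrite -csumD; apply: eq_csum => -[|[|m]].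
  - by rewrite cbh_part0 /cbh_part_series big_geq // mul0r omega0 addr0.
  - rewrite cbh_part1 [X in X * k](_ : _ = 0) ?mul0r ?omega0 ?addr0 //.
    by apply: coef2_inj => i j; rewrite coef2_cbh_part_series.
  rewrite add0r /cbh_part_series mulr_suml omega_sum; apply: eq_bigr => n _.
  rewrite mulr_suml omega_sum; apply: eq_bigr => p /andP[_ /eqP pm].
  rewrite -fps_scaleAl omegaZ -lbr_dyn; last by rewrite size_word pm.
  by rewrite cbh_wordE.
move=> i j; under eq_bigr do rewrite coef2M.
rewrite exchange_big coef2M; apply: eq_bigr => a _.
rewrite exchange_big; apply: eq_bigr => b _ /=.
rewrite -mulr_suml; congr (_ * _).
(* Only words of length [a + b + 2] have a coefficient at [(a, b)], and that length is within the
   range of summation. *)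
have ab : ((a + b).+2 < (i + j).+3)%N.
  by have := ltn_ord a; have := ltn_ord b; lia.
rewrite (bigD1 (Ordinal ab)) //= big1 ?addr0 // => m.
by rewrite -val_eqE /= => hm; rewrite coef2_cbh_part_series.
Qed.

Lemma phibar_omega alpha :
  phibar alpha x y = omega (fps_subst (Fps2 alpha) v w * k).
Proof.
set s := fun m : nat => \sum_(a < m.+1) alpha a (m - a)%N *: (v ^+ a * w ^+ (m - a)).
have hs m : ford m (s m).
  apply: ford_sum => a _; apply/fordZ.
  have am : (a + (m - a) = m)%N by rewrite subnKC // -ltnS.
  by rewrite -[X in ford X]am; apply: fordM; apply: fordX; exact: hdeg_ford.
rewrite -(@csum_omega (fun m => s m * k)).
  apply: eq_csum => m; rewrite /phi_part mulr_suml omega_sum.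
  apply: eq_bigr => a _; rewrite br_wordE lie_xy -fps_scaleAl omegaZ; congr (_ *: _).
  rewrite -mulrA; move: (m - a)%N => c; elim: (nat_of_ord a) => [|b IH]; last by rewrite iterS IH lie_x exprS mulrA.
  rewrite mul1r [iter 0 _ _]/=; elim: c => [|b IH]; first by rewrite mul1r.
  by rewrite iterS IH lie_y exprS mulrA.
move=> i j; rewrite -[fps_subst _ _ _]/(fps_sum s) fps_sumM //.
apply: (@fps_sumE _ (fun m => s m * k)) => [n|]; last by rewrite ltnS; lia.
by rewrite -[X in ford X]addn0; apply: fordM => //; exact: ford0.
Qed.

End Cbh.
End Hat.

Section Subst.
Variable K : numFieldType.

Lemma fps_substC (alpha : nat -> nat -> K) g h :
  (forall k l, alpha k l = alpha l k) ->
  fps_subst (Fps2 alpha) g h = fps_subst (Fps2 alpha) h g.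
Proof.
move=> sym; apply: eq_fps_sum => m.
rewrite [LHS](reindex_inj rev_ord_inj); apply: eq_bigr => k _.
have km : (k <= m)%N by rewrite -ltnS.
rewrite [X in _ *: X]mulrC -[nat_of_ord (rev_ord k)]/(m.+1 - k.+1)%N subSS (subKn km).
by rewrite -[coef2 _ _ _]/(alpha (m - k)%N k) sym.
Qed.

Lemma coef2_lamX_muX k l i j :
  coef2 (lam ^+ k * mu ^+ l) i j = ((i == k) && (j == l))%:R :> K.
Proof.
elim: k i => [|k IH] i; first by rewrite mul1r coef2_muX.
by rewrite exprS -mulrA coef2_lamM; case: i.
Qed.

Lemma fps_subst_id (f : fps2 K) : fps_subst f lam mu = f.
Proof.
apply: coef2_inj => i j; rewrite -[LHS]/(\sum_(m < (i + j).+1)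
  coef2 (\sum_(k < m.+1) coef2 f k (m - k)%N *: (lam ^+ k * mu ^+ (m - k))) i j).
rewrite big_ord_recr big1 => [|m _].
  rewrite Monoid.mul1m coef2_sum; have ij : (i < (i + j).+1)%N by rewrite ltnS leq_addr.
  rewrite (bigD1 (Ordinal ij)) // big1 => [|k].
    by rewrite Monoid.mulm1 coef2Z coef2_lamX_muX eqxx addKn eqxx mulr1.
  rewrite -val_eqE => ki; have {}ki : nat_of_ord k != i := ki.
  by rewrite coef2Z coef2_lamX_muX [i == _]eq_sym (negPf ki) mulr0.
rewrite coef2_sum big1 // => k _.
rewrite coef2Z coef2_lamX_muX; case: andP => [[/eqP ik /eqP jk]|]; last by rewrite mulr0.
have := ltn_ord k; rewrite ltnS => km; have := ltn_ord m.
by rewrite [X in (_ < X + _)%N]ik [X in (_ < _ + X)%N]jk subnKC ?ltnn.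
Qed.

End Subst.

(** * Relations and a faithful model of the chord algebra *)

Section LbarRelations.
Local Open Scope quotient_scope.
Variables (K : numFieldType) (n : nat).
Implicit Types i j k l : 'I_n.

Local Notation pr := (\pi_(presented (@chord_rel K n))).

Lemma pi_relB s t : chord_rel (LSub s t) -> pr s = pr t.
Proof.
move=> h; apply/eqP; rewrite -subr_eq0 -scaleN1r -Defs.pi_scale -Defs.pi_add.
by apply/eqP/presentedP; exact: le_rel.
Qed.

Lemma metab_Lbar : metabelian (Lbar K n).
Proof.
move=> x y z t.
have [x' <-] := lie_proj_surj x; have [y' <-] := lie_proj_surj y.
have [z' <-] := lie_proj_surj z; have [t' <-] := lie_proj_surj t.
rewrite -!lie_proj_lie; apply/lie_proj_eq0.
have D u v : derived1 (lie u v : Lie_n K n).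
  by rewrite -[lie u v]scale1r -[X in derived1 X]addr0; apply: lie_spanD => //; exact: lie_span0.
rewrite -[X in derived2 X]addr0 -[lie (lie _ _) _]scale1r.
by apply: lie_spanD => //; exact: lie_span0.
Qed.

Lemma tbar_sym i j (h : i != j) (h' : j != i) : tbar K h = tbar K h'.
Proof. by congr lie_proj; apply: pi_relB; exact: chord_sym. Qed.

Lemma tbar_lieE i j k l (h : i != j) (h' : k != l) : lie (tbar K h) (tbar K h') =
  lie_proj (derived2_ideal _) (pr (LBr (tterm K h) (tterm K h'))).
Proof. by rewrite Defs.pi_lie lie_proj_lie. Qed.

Lemma tbar_comm i j k l (h : i != j) (h' : k != l) :
  uniq [:: i; j; k; l] -> lie (tbar K h) (tbar K h') = 0.
Proof.
move=> u; rewrite tbar_lieE.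
have -> : pr (LBr (tterm K h) (tterm K h')) = 0.
  by rewrite -Defs.pi_zero; apply/presentedP/le_rel; exact: chord_comm.
by apply/lie_proj_eq0; exact: ideal0 (derived2_ideal _).
Qed.

Lemma tbar_4T i j k (hij : i != j) (hjk : j != k) (hki : k != i) :
  lie (tbar K hij) (tbar K hjk) = lie (tbar K hjk) (tbar K hki).
Proof. by rewrite !tbar_lieE; congr lie_proj; apply: pi_relB; exact: chord_4T. Qed.

Lemma deg1_that i j (h : i != j) : deg1 (that K h) (tbar K h).
Proof. by []. Qed.

Lemma homog_tbar i j (h : i != j) : homog (@tgens K n) 1 (tbar K h).
Proof. by apply: homog_gen; exists i, j, h. Qed.

Lemma hcomp_lie_that i j k l (h : i != j) (h' : k != l) d :
  hcomp (lie (that K h) (that K h')) d =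
  if d == 2%N then lie (tbar K h) (tbar K h') else 0.
Proof.
case: d => [|d]; first exact: hcomp0.
rewrite (hcomp_lie1 _ _ (deg1_that h)) (deg1_that h').
by case: d => [|[|d]] /=; rewrite ?liex0.
Qed.

Lemma that_sym i j (h : i != j) (h' : j != i) : that K h = that K h'.
Proof. by apply: hcomp_inj => d /=; rewrite (tbar_sym h h'). Qed.

Lemma that_comm i j k l (h : i != j) (h' : k != l) :
  uniq [:: i; j; k; l] -> lie (that K h) (that K h') = 0.
Proof.
move=> u; apply: hcomp_inj => d; rewrite hcomp_lie_that tbar_comm //.
by case: eqP.
Qed.

Lemma that_4T i j k (hij : i != j) (hjk : j != k) (hki : k != i) :
  lie (that K hij) (that K hjk) = lie (that K hjk) (that K hki).
Proof. by apply: hcomp_inj => d; rewrite !hcomp_lie_that (tbar_4T hij hjk hki). Qed.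

End LbarRelations.

(** * Maps from the chord algebra to a metabelian Lie algebra *)

Section Lift.
Local Open Scope quotient_scope.
Variables (K : numFieldType) (n : nat) (M : lieAlgType K) (g : chord n -> M).

Fixpoint lie_eval (t : lie_term K (chord n)) : M :=
  match t with
  | LGen x => g x
  | LZero => 0
  | LAdd s t => lie_eval s + lie_eval t
  | LScale a t => a *: lie_eval t
  | LBr s t => lie (lie_eval s) (lie_eval t)
  end.

Hypothesis metabM : metabelian M.
Hypothesis g_rel : forall r, chord_rel r -> lie_eval r = 0.

Lemma lie_eval_eq s t : lie_eq (@chord_rel K n) s t -> lie_eval s = lie_eval t.
Proof.
elim=> //=; do ?[by move=> *; congruence].
- by move=> *; rewrite addrA.
- by move=> *; rewrite addrC.
- by move=> *; rewrite add0r.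
- by move=> *; rewrite scaleN1r addNr.
- by move=> *; rewrite scalerA.
- by move=> *; rewrite scale1r.
- by move=> *; rewrite scalerDr.
- by move=> *; rewrite scalerDl.
- by move=> *; rewrite lieDl.
- by move=> *; rewrite lieDr.
- by move=> *; rewrite lieZl.
- by move=> *; rewrite lieZr.
- by move=> *; rewrite liexx.
- by move=> *; rewrite lie_jacobi.
Qed.

Definition lift_pr (x : Lie_n K n) : M := lie_eval (repr x).

Lemma lift_prE t : lift_pr (\pi_(presented (@chord_rel K n)) t) = lie_eval t.
Proof. by apply: lie_eval_eq; exact: pr_reprE. Qed.

Lemma lift_prD x y : lift_pr (x + y) = lift_pr x + lift_pr y.
Proof.
rewrite -[x]pr_reprK -[y]pr_reprK -Defs.pi_add !lift_prE //.
Qed.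

Lemma lift_prZ a x : lift_pr (a *: x) = a *: lift_pr x.
Proof. by rewrite -[x]pr_reprK -Defs.pi_scale !lift_prE. Qed.

Lemma lift_pr_lie x y : lift_pr (lie x y) = lie (lift_pr x) (lift_pr y).
Proof. by rewrite -[x]pr_reprK -[y]pr_reprK -Defs.pi_lie !lift_prE. Qed.

Lemma lift_pr0 : lift_pr 0 = 0.
Proof. by rewrite -[0](scale0r 0) lift_prZ scale0r. Qed.

Lemma lift_pr_derived1 x : derived1 x -> exists s : seq (M * M),
  lift_pr x = \sum_(p <- s) lie p.1 p.2.
Proof.
elim=> [|a y z t _ _ _ [s hs]]; first by exists [::]; rewrite big_nil lift_pr0.
exists ((a *: lift_pr y, lift_pr z) :: s).
by rewrite big_cons /= lieZl lift_prD lift_prZ lift_pr_lie hs.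
Qed.

Lemma lift_pr_derived2 x : derived2 x -> lift_pr x = 0.
Proof.
elim=> [|a y z t hy hz _ ht]; first exact: lift_pr0.
rewrite lift_prD lift_prZ lift_pr_lie ht addr0.
have [s ->] := lift_pr_derived1 hy; have [s' ->] := lift_pr_derived1 hz.
by rewrite lie_suml big1 ?scaler0 // => p _; rewrite lie_sumr big1.
Qed.

Definition lie_lift (x : Lbar K n) : M := lift_pr (repr x).

(** The chosen representative differs from [x] by an element of [derived2], which a metabelian
    target kills. *)
Lemma lie_liftE x : lie_lift (lie_proj (derived2_ideal _) x) = lift_pr x.
Proof.
apply/eqP; rewrite -subr_eq0 -scaleN1r -lift_prZ -lift_prD scaleN1r; apply/eqP.
by apply: lift_pr_derived2; exact: lq_reprE.
Qed.

Lemma lie_lift_tbar i j (h : i != j) :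
  lie_lift (tbar K h) = g (exist (fun p : 'I_n * 'I_n => p.1 != p.2) (i, j) h).
Proof. by rewrite lie_liftE lift_prE. Qed.

Lemma lie_liftD x y : lie_lift (x + y) = lie_lift x + lie_lift y.
Proof.
have [x' <-] := lie_proj_surj x; have [y' <-] := lie_proj_surj y.
by rewrite -lie_projD !lie_liftE lift_prD.
Qed.

Lemma lie_liftZ a x : lie_lift (a *: x) = a *: lie_lift x.
Proof.
by have [x' <-] := lie_proj_surj x; rewrite -lie_projZ !lie_liftE lift_prZ.
Qed.

Lemma lie_lift_lie x y : lie_lift (lie x y) = lie (lie_lift x) (lie_lift y).
Proof.
have [x' <-] := lie_proj_surj x; have [y' <-] := lie_proj_surj y.
by rewrite -lie_proj_lie !lie_liftE lift_pr_lie.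
Qed.

Lemma lie_lift_sum (I : Type) (r : seq I) (P : pred I) (F : I -> Lbar K n) :
  lie_lift (\sum_(i <- r | P i) F i) = \sum_(i <- r | P i) lie_lift (F i).
Proof.
apply: (big_morph lie_lift lie_liftD); by rewrite -[0](scale0r 0) lie_liftZ scale0r.
Qed.

End Lift.

(** Target of a Magnus-type embedding: the pair [(v, g)] stands for the abelian
    part [v] and the Fox derivative [g]. *)
Definition magnus (K : numFieldType) : Type := (fps2 K * fps2 K)%type.

Section Magnus.
Variable K : numFieldType.
HB.instance Definition _ := GRing.Lmodule.on (magnus K).
Implicit Types x y z : magnus K.

(** The semidirect product of the abelian Lie algebra of series with the series as a module over it
    by multiplication. *)
Definition mg_lie x y : magnus K := (0, x.1 * y.2 - y.1 * x.2).

Lemma mg_lieDl x y z : mg_lie (x + y) z = mg_lie x z + mg_lie y z.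
Proof. by congr pair; rewrite /= ?addr0 //; ring. Qed.
Lemma mg_lieDr x y z : mg_lie z (x + y) = mg_lie z x + mg_lie z y.
Proof. by congr pair; rewrite /= ?addr0 //; ring. Qed.
Lemma mg_lieZl a x y : mg_lie (a *: x) y = a *: mg_lie x y.
Proof.
congr pair; rewrite /= ?scaler0 // scalerDr scalerN.
by rewrite fps_scaleAl fps_scaleAr.
Qed.
Lemma mg_lieZr a x y : mg_lie y (a *: x) = a *: mg_lie y x.
Proof.
congr pair; rewrite /= ?scaler0 // scalerDr scalerN.
by rewrite fps_scaleAr fps_scaleAl.
Qed.
Lemma mg_liexx x : mg_lie x x = 0.
Proof. by congr pair; rewrite /= subrr. Qed.
Lemma mg_jacobi x y z :
  mg_lie x (mg_lie y z) + mg_lie y (mg_lie z x) + mg_lie z (mg_lie x y) = 0.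
Proof. by congr pair; rewrite /= ?addr0 //; ring. Qed.
HB.instance Definition _ := isLieAlgebra.Build K (magnus K)
  mg_lieDl mg_lieDr mg_lieZl mg_lieZr mg_liexx mg_jacobi.

Lemma mg_lieE x y : lie x y = (0, x.1 * y.2 - y.1 * x.2).
Proof. by []. Qed.

Lemma metab_magnus : metabelian (magnus K).
Proof. by move=> x y z t; rewrite !mg_lieE /= !mul0r subrr. Qed.

(** A chord of ['I_3] is identified by the sum of its endpoints; [t12], [t23] and
    [t13] are sent to [(mu, 0)], [(lam, 1)] and [(- lam - mu, -1)]. *)
Definition mg_gen (p : chord 3) : magnus K :=
  match (val (sval p).1 + val (sval p).2)%N with
  | 1 => (mu, 0)
  | 2 => (- lam - mu, -1)
  | _ => (lam, 1)
  end.

(** The three images sum to 0, and [x + y + z = 0] gives [[x, y] = [y, z] = [z, x]]. *)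
Lemma mg_rel r : chord_rel r -> lie_eval mg_gen r = 0.
Proof.
case=> [i j hij hji | i j k l hij hkl u | i j k hij hjk hki | i j k hij hjk hki].
- by rewrite /= scaleN1r /mg_gen /= addnC subrr.
(* Four distinct indices do not fit in ['I_3]. *)
- have := card_uniqP u; rewrite /=.
  by move/eqP; rewrite eqn_leq => /andP[_ /leq_trans /(_ (max_card _))]; rewrite card_ord.
- rewrite /= scaleN1r; apply/eqP; rewrite subr_eq0; apply/eqP.
  move: hij hjk hki; case: i => [[|[|[|i]]] hi] //; case: j => [[|[|[|j]]] hj] //;
  case: k => [[|[|[|k]]] hk] //= hij hjk hki; rewrite !mg_lieE /mg_gen /=; congr pair; ring.
- rewrite /= scaleN1r; apply/eqP; rewrite subr_eq0; apply/eqP.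
  move: hij hjk hki; case: i => [[|[|[|i]]] hi] //; case: j => [[|[|[|j]]] hj] //;
  case: k => [[|[|[|k]]] hk] //= hij hjk hki; rewrite !mg_lieE /mg_gen /=; congr pair; ring.
Qed.

End Magnus.

(** * The hexagon equation on power series *)

Section HexagonSeries.
Variable K : numFieldType.
Implicit Types f g p q v w : fps2 K.
Local Notation lam := (lam : fps2 K).
Local Notation mu := (mu : fps2 K).
Local Notation C := (- lam - mu : fps2 K).

Lemma hdeg_C : hdeg 1 C.
Proof. by apply: hdegD; apply: hdegN; [exact: hdeg_lam | exact: hdeg_mu]. Qed.

Lemma expq_mul v : hdeg 1 v -> v * expq v = fexp v - 1.
Proof.
move=> hv; rewrite (fexpq (hdeg_ford hv)) [1 + _]addrC addrK; reflexivity.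
Qed.

Lemma reg_opp v : (forall h, v * h = 0 -> h = 0) -> forall h, - v * h = 0 -> h = 0.
Proof. by move=> reg h /eqP; rewrite mulNr oppr_eq0 => /eqP /reg. Qed.

Lemma fexpN v : hdeg 1 v -> fexp (- v) * fexp v = 1.
Proof. by move=> hv; rewrite -(fexpD (hdegN hv) hv) addNr fexp0. Qed.

Lemma expqN v : hdeg 1 v -> (forall h, v * h = 0 -> h = 0) ->
  fexp (- v) * expq v = expq (- v).
Proof.
move=> hv reg; apply/subr0_eq/reg.
have -> : v * (fexp (- v) * expq v - expq (- v)) =
  fexp (- v) * (v * expq v) + - v * expq (- v) by ring.
rewrite (expq_mul hv) (expq_mul (hdegN hv)) mulrBr fexpN //; ring.
Qed.

(** Coordinate form of [e^x e^f = e^(exp(ad x) f) e^x]. If [x] acts as [v], then [e^(x + g)] is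
    [e^(expq v * g) e^x], so [expq v * g] is the coordinate in which multiplication is linear. *)
Lemma cbh_derived_r v f : hdeg 1 v -> (forall h, v * h = 0 -> h = 0) ->
  expq v * (f + cbh_series v 0 * (v * f)) = fexp v * f.
Proof.
move=> hv reg; have := @cbh_series_l _ v 0 hv (@hdeg0 K 1); rewrite addr0 => /(_ reg) H.
have -> : expq v * (f + cbh_series v 0 * (v * f)) =
  expq v * f + (expq v * (v * cbh_series v 0)) * f by ring.
by rewrite H expq0; ring.
Qed.

(** In the coordinate [expq w * g], left multiplication by the exponential of a derived element is a
    translation. *)
Lemma cbh_derived_l w p g : hdeg 1 w -> (forall h, w * h = 0 -> h = 0) ->
  expq w * (p + g + cbh_series 0 w * (- (w * p))) = p + expq w * g.
Proof.
move=> hw reg; have := @cbh_series_r _ 0 w (@hdeg0 K 1) hw; rewrite add0r => /(_ reg) H.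
have -> : expq w * (p + g + cbh_series 0 w * (- (w * p))) =
  expq w * p + expq w * g - (expq w * (w * cbh_series 0 w)) * p by ring.
by rewrite H expq0; ring.
Qed.

Lemma C_lam : C + lam = - mu. Proof. by ring. Qed.

(** Multiplication by [e^c] on the left of [e^(b + g)]: the coordinate of [g] is twisted by
    [fexp C], and the last term is the coordinate of [log (e^c e^b)], since [[c, b]] has series
    -1. *)
Lemma cbh_C_lam g :
  expq (- mu) * (g + cbh_series C lam * (- 1 + C * g)) =
  fexp C * (expq lam * g) - expq (- mu) * cbh_series C lam.
Proof.
have := @cbh_series_l _ C lam hdeg_C (hdeg_lam K); rewrite C_lam.
move=> /(_ (reg_opp (@mu_reg K))) H.
have -> : expq (- mu) * (g + cbh_series C lam * (- 1 + C * g)) =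
  expq (- mu) * g + (expq (- mu) * (C * cbh_series C lam)) * g
   - expq (- mu) * cbh_series C lam by ring.
by rewrite H; ring.
Qed.

(** The right side of the stated identity is the contribution of [e^c e^b] alone, up to the factor
    [fexp mu]. *)
Lemma hexagon_rhs :
  fps_div (fps_div (fps_exp mu - 1) mu + fps_div (fps_exp (- lam) - 1) lam)
          (lam + mu) = fexp mu * (expq (- mu) * cbh_series C lam).
Proof.
have hl := hdeg_lam K; have hm := hdeg_mu K.
have Em : fps_div (fps_exp mu - 1) mu = expq mu.
  by apply: fps_divE; [exact: mu_reg | rewrite fps_expE expq_mul].
have El : fps_div (fps_exp (- lam) - 1) lam = - expq (- lam).
  apply: fps_divE; first exact: lam_reg.
  by rewrite fps_expE mulrN -mulNr expq_mul //; exact: hdegN.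
apply: fps_divE; first exact: lam_mu_reg.
transitivity (expq mu - expq (- lam)); last exact: esym (congr2 +%R Em El).
have H := cbh_series_eq hdeg_C hl; rewrite C_lam -(expq_mul (hdegN hm)) in H.
(* A further factor [mu] turns [expq (- mu)] into [fexp (- mu) - 1] up to sign, so that
   [cbh_series_eq] eliminates the CBH series. *)
apply/subr0_eq/mu_reg.
have -> : mu * ((lam + mu) * (fexp mu * (expq (- mu) * cbh_series C lam)) -
     (expq mu - expq (- lam))) =
   - (lam + mu) * fexp mu * (- mu * expq (- mu) * cbh_series C lam)
   - mu * expq mu + mu * expq (- lam) by ring.
rewrite H.
have -> : - (lam + mu) * fexp mu * (fexp C * expq lam - expq C) =
  - (fexp mu * (C * expq C)) - (lam + mu) * expq lam * (fexp C * fexp mu) by ring.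
rewrite (expq_mul hdeg_C) -(fexpD hdeg_C hm) subrK mulrBr [fexp mu * _]mulrC.
rewrite -(fexpD hdeg_C hm) subrK.
have -> : (lam + mu) * expq lam * fexp (- lam) =
   lam * expq lam * fexp (- lam) + mu * (fexp (- lam) * expq lam) by ring.
rewrite (expq_mul hl) mulrBl mul1r [fexp lam * _]mulrC (fexpN hl).
rewrite (expqN hl (@lam_reg K)) (expq_mul hm); ring.
Qed.

(** The exponent of [e^{phi(c,a)} e^c e^{-phi(c,b)} e^b e^{phi(a,b)} e^{-b-c}]
    vanishes exactly when the series identity holds; [p], [q], [f] are the
    series of [phi(c,a)], [- phi(c,b)] and [phi(a,b)]. *)
Lemma hexagon_series f p q
  (g1 := f + cbh_series lam 0 * (lam * f))
  (g2 := q + g1 + cbh_series 0 lam * (- (lam * q)))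
  (g3 := g2 + cbh_series C lam * (- 1 + C * g2))
  (g4 := p + g3 + cbh_series 0 (- mu) * (- (- mu * p))) :
  g4 = 0 <-> f + fexp mu * p + fexp (- lam) * q =
    fexp mu * (expq (- mu) * cbh_series C lam).
Proof.
have hl := hdeg_lam K; have hm := hdeg_mu K; have hmN := hdegN hm.
have E1 : expq lam * g1 = fexp lam * f by apply: cbh_derived_r => //; exact: lam_reg.
have E2 : expq lam * g2 = q + expq lam * g1.
  by apply: cbh_derived_l => //; exact: lam_reg.
have E3 := cbh_C_lam g2; rewrite -/g3 in E3.
have E4 : expq (- mu) * g4 = p + expq (- mu) * g3.
  by apply: cbh_derived_l => //; apply: reg_opp; exact: mu_reg.
set h := expq (- mu) * cbh_series _ _ in E3 *.
have e1 : fexp C * fexp mu = fexp (- lam) by rewrite -(fexpD hdeg_C hm) subrK.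
(* Multiplied by two series of constant term 1, [g4] becomes the difference of the two sides of the
   identity. *)
have e2 : fexp mu * (expq (- mu) * g4) =
    f + fexp mu * p + fexp (- lam) * q - fexp mu * h.
  rewrite E4 E3 E2 E1.
  have -> : fexp mu * (p + (fexp C * (q + fexp lam * f) - h)) =
    fexp mu * p + (fexp C * fexp mu) * q + (fexp C * fexp mu) * fexp lam * f
     - fexp mu * h by ring.
  by rewrite e1 (fexpN hl); ring.
split=> [g0|e].
  by apply/subr0_eq; rewrite -e2 g0 !mulr0.
have {}e2 : fexp mu * (expq (- mu) * g4) = 0 by rewrite e2 e subrr.
apply: (@unit_reg _ (expq (- mu))); first by rewrite coef00_expq oner_eq0.
by apply: unit_reg e2; rewrite coef00_exp oner_eq0.
Qed.

End HexagonSeries.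

(** * The hexagon equation *)

Section Hexagon.
Variable K : numFieldType.

Let o0 : 'I_3 := @Ordinal 3 0 isT.
Let o1 : 'I_3 := @Ordinal 3 1 isT.
Let o2 : 'I_3 := @Ordinal 3 2 isT.
Let h01 : o0 != o1 := isT.
Let h12 : o1 != o2 := isT.
Let h02 : o0 != o2 := isT.
Let h20 : o2 != o0 := isT.

Let X := tbar K h01.
Let Y := tbar K h12.
Let Z := tbar K h02.
Let a := that K h01.
Let b := that K h12.
Let c := that K h02.

Let hX : homog (@tgens K 3) 1 X := homog_tbar K h01.
Let hY : homog (@tgens K 3) 1 Y := homog_tbar K h12.
Let metab := @metab_Lbar K 3.

(* [lam] acts as [ad b] and [mu] as [ad a], not the other way round: with this
   choice, harmless since [alpha] is symmetric, the identity comes out in the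
   stated form. *)
Notation om := (omega hX hY).
Local Notation lam := (lam : fps2 K).
Local Notation mu := (mu : fps2 K).
Local Notation C := (- lam - mu : fps2 K).

Let lieXY : lie X Y = lie Y Z.
Proof. by rewrite (tbar_4T K h01 h12 h20) (tbar_sym K h20 h02). Qed.

Let lieYZ : lie Y Z = lie Z X.
Proof. by have := tbar_4T K h12 h20 h01; rewrite (tbar_sym K h20 h02). Qed.

(** [X + Y + Z] commutes with [X] and with [Y], hence kills every word in them. *)
Let lie_c_adm k l : lie Z (adm X Y k l) = - lie Y (adm X Y k l) - lie X (adm X Y k l).
Proof.
have sX : lie (X + Y + Z) X = 0.
  by rewrite !lieDl liexx add0r -lieYZ -lieXY [lie Y X]lie_anti addNr.
have sY : lie (X + Y + Z) Y = 0.
  by rewrite !lieDl liexx addr0 [lie Z Y]lie_anti lieXY subrr.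
have : lie (X + Y + Z) (adm X Y k l) = 0.
  rewrite /adm; elim: k => [|k IH]; last by rewrite iterS lie_deriv sY IH lie0x liex0 addr0.
  elim: l => [|l IH]; last by rewrite /= lie_deriv sX IH lie0x liex0 addr0.
  by rewrite /= lie_deriv sX sY lie0x liex0 addr0.
move/eqP; rewrite !lieDl addr_eq0 => /eqP e.
by rewrite -[LHS]opprK -e opprD addrC.
Qed.

Let lie_a f : lie a (om f) = om (mu * f).
Proof. exact: lie_omega_mu. Qed.

Let lie_b f : lie b (om f) = om (lam * f).
Proof. exact: lie_omega_lam. Qed.

Let lie_c f : lie c (om f) = om (C * f).
Proof.
rewrite mulrDl !mulNr omegaD !omegaN -lie_a -lie_b.
apply: hcomp_inj => -[|d]; first by rewrite !hcomp0.
rewrite hcompD (hcomp_lie1 _ _ (deg1_that K h02)).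
rewrite -[hcomp (- lie b _) _]/(- hcomp (lie b (om f)) d.+1) (hcomp_lie1 _ _ (deg1_that K h12)).
rewrite -[hcomp (- lie a _) _]/(- hcomp (lie a (om f)) d.+1) (hcomp_lie1 _ _ (deg1_that K h01)).
case: d => [|[|e]]; rewrite ?hcomp_omega1 ?hcomp0 ?liex0 ?subrr ?oppr0 ?addr0 //.
rewrite hcomp_omega !lie_sumr -!sumrN -big_split; apply: eq_bigr => k _ /=.
by rewrite !lieZr lie_c_adm scalerBr scalerN.
Qed.

Let lie_ab : lie a b = om 1.
Proof. exact: lie_omega1. Qed.

Let lie_bc : lie b c = om 1.
Proof. by rewrite -lie_ab (that_4T K h01 h12 h20) (that_sym K h20 h02). Qed.

Let lie_ca : lie c a = om 1.
Proof. by rewrite -lie_bc; have := that_4T K h12 h20 h01; rewrite (that_sym K h20 h02). Qed.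

(** The factor 0 puts this in the form expected by [cbh_omega]: derived elements act through the
    series 0. *)
Let lie_om f g : lie (om f) (om g) = om (0 * g).
Proof. by rewrite mul0r omega0 lie_omega2. Qed.

Let mg_ab k l : lie_lift (@mg_gen K) (adm X Y k l) = (0, lam ^+ k * mu ^+ l * mu).
Proof.
have LX : lie_lift (@mg_gen K) X = (mu, 0).
  by apply: lie_lift_tbar; [exact: metab_magnus | exact: mg_rel].
have LY : lie_lift (@mg_gen K) Y = (lam, 1).
  by apply: lie_lift_tbar; [exact: metab_magnus | exact: mg_rel].
have LL x y : lie_lift (@mg_gen K) (lie x y) =
    lie (lie_lift (@mg_gen K) x) (lie_lift (@mg_gen K) y).
  by apply: lie_lift_lie; [exact: metab_magnus | exact: mg_rel].
rewrite /adm; elim: k => [|k IH].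
  elim: l => [|l IH]; last first.
    by rewrite iterS LL IH LX mg_lieE /= exprS; congr pair; ring.
  by rewrite /= LL LX LY mg_lieE /=; congr pair; ring.
by rewrite iterS LL IH LY mg_lieE /= exprS; congr pair; ring.
Qed.

(** In the Magnus model the degree [d + 2] component of [om f] becomes [mu] times the part of [f] of
    degree [d], from which each coefficient can be read off. *)
Let omega_inj f : om f = 0 -> f = 0.
Proof.
move=> f0; apply: coef2_inj => i j.
have := congr1 (fun z => lie_lift (@mg_gen K) (hcomp z (i + j).+2)) f0.
have lift0 : lie_lift (@mg_gen K) 0 = 0.
  rewrite -[0 in LHS](scale0r 0) lie_liftZ ?scale0r //; first exact: metab_magnus.
  exact: mg_rel.
rewrite hcomp_omega (lie_lift_sum (@metab_magnus K) (@mg_rel K)) lift0.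
under eq_bigr do rewrite (lie_liftZ (@metab_magnus K) (@mg_rel K)) mg_ab.
(* [[X, Y]] is sent to [(0, mu)], so the coefficient at [(i, j)] appears at [(i, j.+1)]. *)
move/(congr1 (fun p : magnus K => coef2 p.2 i j.+1)).
rewrite (big_morph (fun p : magnus K => p.2) (id1 := 0) (op1 := +%R)) //.
rewrite coef2_sum; have ij : (i < (i + j).+1)%N by rewrite ltnS leq_addr.
have coef k l : coef2 (lam ^+ k * mu ^+ l * mu) i j.+1 = ((i == k) && (j == l))%:R.
  by rewrite mulrC coef2_muM coef2_lamX_muX.
rewrite (bigD1 (Ordinal ij)) // big1 => [|k].
  by rewrite Monoid.mulm1 coef2Z coef eqxx addKn eqxx mulr1.
rewrite -val_eqE => ki; have {}ki : nat_of_ord k != i := ki.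
by rewrite coef2Z coef [i == _]eq_sym (negPf ki) mulr0.
Qed.

(** The factors are multiplied from right to left. The linear part of the running logarithm is [b],
    acting as [lam], until [e^c] enters, and then [c + b], acting as [C + lam = - mu]. *)
Lemma log_prod_exp_hexagon (f p q : fps2 K)
  (g1 := f + cbh_series lam 0 * (lam * f))
  (g2 := q + g1 + cbh_series 0 lam * (- (lam * q)))
  (g3 := g2 + cbh_series C lam * (- 1 + C * g2))
  (g4 := p + g3 + cbh_series 0 (- mu) * (- (- mu * p))) :
  log_prod_exp [:: om p; c; om q; b; om f] = b + c + om g4.
Proof.
have h0 := @hdeg0 K 1; have hl := hdeg_lam K; have hC := hdeg_C K.
have hmN := hdegN (hdeg_mu K).
have lie_bg g f' : lie (b + om g) (om f') = om (lam * f').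
  by rewrite lieDl lie_b lie_om mul0r omega0 addr0.
have lie_cbg g f' : lie (c + b + om g) (om f') = om (- mu * f').
  by rewrite !lieDl lie_c lie_b lie_om mul0r omega0 addr0 -omegaD -mulrDl C_lam.
rewrite /log_prod_exp /= [cbh (om f) 0]cbh_comm ?liex0 // addr0.
have -> : cbh b (om f) = b + om g1.
  by rewrite (cbh_omega hl h0 lie_b (lie_om f) (lie_b f)) -addrA -omegaD.
have -> : cbh (om q) (b + om g1) = b + om g2.
  rewrite (cbh_omega h0 hl (lie_om q) (lie_bg g1) (k := - (lam * q))).
    by rewrite addrCA -addrA -!omegaD.
  by rewrite lie_anti lie_bg omegaN.
have -> : cbh c (b + om g2) = c + b + om g3.
  rewrite (cbh_omega hC hl lie_c (lie_bg g2) (k := - 1 + C * g2)).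
    by rewrite addrA -[LHS]addrA -omegaD.
  by rewrite lieDr lie_c lie_anti lie_bc -omegaN -omegaD.
rewrite (cbh_omega h0 hmN (lie_om p) (lie_cbg g3) (k := - (- mu * p))).
  by rewrite addrCA -addrA -!omegaD [c + b]addrC.
by rewrite lie_anti lie_cbg omegaN.
Qed.

Lemma hexagon_iff (alpha : nat -> nat -> K) (f := Fps2 alpha) :
  (forall k l, alpha k l = alpha l k) ->
  compressed_hexagon alpha <->
  f + fps_exp mu * fps_subst f mu C + fps_exp (- lam) * fps_subst f lam C =
  fps_div (fps_div (fps_exp mu - 1) mu + fps_div (fps_exp (- lam) - 1) lam)
          (lam + mu).
Proof.
move=> sym; rewrite hexagon_rhs !fps_expE.
have pab : phibar alpha a b = om f.
  rewrite (phibar_omega (hdeg_mu K) (hdeg_lam K) lie_a lie_b lie_ab).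
  by rewrite mulr1 fps_substC // fps_subst_id.
have pca : phibar alpha c a = om (fps_subst f mu C).
  rewrite (phibar_omega (hdeg_C K) (hdeg_mu K) lie_c lie_a lie_ca).
  by rewrite mulr1 fps_substC.
have pcb : - phibar alpha c b = om (fps_subst f lam C).
  (* This sign cancels the minus sign in front of [phibar alpha c b]. *)
  have lie_cb : lie c b = om (- 1) by rewrite lie_anti lie_bc omegaN.
  rewrite (phibar_omega (hdeg_C K) (hdeg_lam K) lie_c lie_b lie_cb).
  rewrite mulrN1 omegaN opprK (fps_substC C lam sym); reflexivity.
rewrite -hexagon_series /compressed_hexagon.
rewrite -[log_prod_exp _]/(log_prod_exp
  [:: phibar alpha c a; c; - phibar alpha c b; b; phibar alpha a b]).
rewrite pab pca pcb log_prod_exp_hexagon -[X in X = _]addr0.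
by split=> [/addrI /esym /omega_inj // | ->]; rewrite omega0.
Qed.

End Hexagon.

(** * The pentagon equation *)

Section IterLie.
Variables (K : numFieldType) (L : lieAlgType K).
Implicit Types x y z u v : L.

Lemma iter_lieD k x u v :
  iter k (lie x) (u + v) = iter k (lie x) u + iter k (lie x) v.
Proof. by elim: k => //= k ->; rewrite lieDr. Qed.

Lemma iter_lieN k x u : iter k (lie x) (- u) = - iter k (lie x) u.
Proof. by elim: k => //= k ->; rewrite liexN. Qed.

Lemma iter_lieB k x u v :
  iter k (lie x) (u - v) = iter k (lie x) u - iter k (lie x) v.
Proof. by rewrite iter_lieD iter_lieN. Qed.

Definition adcomm z := forall u v, lie u (lie v z) = lie v (lie u z).

Lemma adcommD y z : adcomm y -> adcomm z -> adcomm (y + z).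
Proof. by move=> hy hz u v; rewrite !lieDr hy hz. Qed.

Lemma adcommN z : adcomm z -> adcomm (- z).
Proof. by move=> hz u v; rewrite !liexN hz. Qed.

Lemma iter_lieC k x v z : adcomm z ->
  (forall y, adcomm y -> adcomm (lie x y)) ->
  lie v (iter k (lie x) z) = iter k (lie x) (lie v z).
Proof.
move=> hz hx; suff [_ <-//] : adcomm (iter k (lie x) z) /\
  lie v (iter k (lie x) z) = iter k (lie x) (lie v z).
by elim: k => [|k [IH1 IH2]] //=; split; [exact: hx | rewrite -IH2 IH1].
Qed.

(** The reflection of [k] to [m - k] fixes [alpha] and changes the sign of [F], so the sum equals
    its own opposite. *)
Lemma antisym_sum0 (alpha : nat -> nat -> K) (F : nat -> nat -> L) m :
  (forall k l, alpha k l = alpha l k) -> (forall k l, F k l = - F l k) ->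
  \sum_(k < m.+1) alpha k (m - k)%N *: F k (m - k)%N = 0.
Proof.
move=> sym anti; set S := \sum_(k < _) _.
have SN : S = - S.
  rewrite {1}/S (reindex_inj rev_ord_inj) -sumrN; apply: eq_bigr => k _ /=.
  have km : (k <= m)%N by rewrite -ltnS.
  by rewrite subSS subKn // sym anti scalerN.
have : S *+ 2 = 0 by rewrite mulr2n {1}SN addNr.
rewrite -scaler_nat => /eqP; rewrite scaler_eq0 pnatr_eq0 /= => /eqP //.
Qed.

End IterLie.

Lemma uniq3P (I : eqType) (i j k : I) :
  reflect [/\ i <> j, i <> k & j <> k] (uniq [:: i; j; k]).
Proof.
rewrite /= !inE !negb_or andbT; apply: (iffP idP).
  by case/andP=> /andP[/eqP ? /eqP ?] /eqP.
by case=> /eqP -> /eqP -> /eqP.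
Qed.

Lemma uniq4P (I : eqType) (i j k l : I) :
  reflect ([/\ i <> j, i <> k & i <> l] /\ [/\ j <> k, j <> l & k <> l])
    (uniq [:: i; j; k; l]).
Proof.
rewrite /= !inE !negb_or andbT; apply: (iffP idP).
  by case/and3P=> /and3P[/eqP ? /eqP ? /eqP ?] /andP[/eqP ? /eqP ?] /eqP.
by case=> [[/eqP -> /eqP -> /eqP ->] [/eqP -> /eqP -> /eqP]].
Qed.

Ltac uniq_by H :=
  first [move/uniq4P: (H) => [[? ? ?] [? ? ?]] | move/uniq3P: (H) => [? ? ?]];
  first [apply/uniq4P; do !split | apply/uniq3P; split]; congruence.

(** * Action of the edges of a tetrahedron on its faces *)

Section Tetrahedron.
Variables (K : numFieldType) (L : lieAlgType K) (metab : metabelian L).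
Variables (I : eqType) (T : I -> I -> L).
Hypothesis T_sym : forall i j, T i j = T j i.
Hypothesis T_comm : forall i j k l, uniq [:: i; j; k; l] -> lie (T i j) (T k l) = 0.
Hypothesis T_4T : forall i j k, uniq [:: i; j; k] ->
  lie (T i j) (T j k) = lie (T j k) (T k i).
Implicit Types u v w : L.
Local Notation adcomm := (@adcomm K L).

Let tw i j k := lie (T i j) (T j k).

Lemma adcomm_lie u v : adcomm (lie u v).
Proof. by move=> x y; exact: metab_lieCA. Qed.

Lemma lie_iterC n x v z : adcomm z ->
  lie v (iter n (lie x) z) = iter n (lie x) (lie v z).
Proof. by move=> hz; apply: iter_lieC => // y _; exact: adcomm_lie. Qed.

Lemma adcomm_iter n x z : adcomm z -> adcomm (iter n (lie x) z).
Proof. by case: n => //= n _; exact: adcomm_lie. Qed.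

Lemma iter_iterC n m x y z : adcomm z ->
  iter n (lie x) (iter m (lie y) z) = iter m (lie y) (iter n (lie x) z).
Proof.
move=> hz; elim: n => //= n ->; rewrite lie_iterC //; exact: adcomm_iter.
Qed.

Lemma tw_rot i j k : uniq [:: i; j; k] -> tw i j k = tw j k i.
Proof. exact: T_4T. Qed.

Lemma tw_rev i j k : tw k j i = - tw i j k.
Proof. by rewrite /tw lie_anti (T_sym j i) (T_sym k j). Qed.

(** [T i l] commutes with the disjoint edge [T j k], so by Leibniz only its bracket with [T i j]
    survives, and that bracket is the face [ijl]. *)
Lemma lie_tw i j k l : uniq [:: i; j; k; l] ->
  lie (T i l) (tw i j k) = - lie (T j k) (tw i j l).
Proof.
move=> u; rewrite {1}/tw lie_deriv [lie (T i l) (T j k)]T_comm; last by uniq_by u.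
rewrite liex0 addr0 lie_anti (T_sym i l) -[lie (T l i) _]/(tw l i j) tw_rot //.
by uniq_by u.
Qed.

Definition tri i j k u := lie (T i j) u + lie (T j k) u + lie (T k i) u = 0.

Lemma tri_rot i j k u : tri i j k u -> tri j k i u.
Proof. by rewrite /tri => <-; rewrite addrC addrA. Qed.

Lemma tri_rev i j k u : tri i j k u -> tri k j i u.
Proof. by rewrite /tri (T_sym k j) (T_sym j i) (T_sym i k) => <-; rewrite addrAC addrC addrA addrAC. Qed.

Lemma triN i j k u : tri i j k u -> tri i j k (- u).
Proof. by rewrite /tri !liexN -!opprD => ->; rewrite oppr0. Qed.

Lemma tri_lie i j k u v : adcomm u -> tri i j k u -> tri i j k (lie v u).
Proof. by move=> hu; rewrite /tri !(hu _ v) -!lieDr => ->; rewrite liex0. Qed.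

(** Writing the face in its three cyclic forms, one per edge, turns the triangle sum into the Jacobi
    identity. *)
Lemma tri_tw i j k : uniq [:: i; j; k] -> tri i j k (tw i j k).
Proof.
move=> u; have e1 := tw_rot u.
have e2 : tw i j k = tw k i j.
  by rewrite e1; apply: tw_rot; uniq_by u.
rewrite /tri {1}e1 {1}e2; exact: lie_jacobi.
Qed.

Variables p q r s : I.
Hypothesis upqrs : uniq [:: p; q; r; s].

Let w123 := tw p q r.
Let w124 := tw p q s.
Let w134 := tw p r s.
Let w234 := tw q r s.
Let u1 := lie (T p s) w123.
Let u2 := lie (T q s) w123.
Let u3 := lie (T r s) w123.

(** On such elements the six edges reduce to three commuting operators of sum 0, one per pair of
    opposite edges. *)
Definition good u := [/\ adcomm u, lie (T p q) u = lie (T r s) u,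
  lie (T p r) u = lie (T q s) u, lie (T p s) u = lie (T q r) u
  & lie (T p q) u + lie (T p r) u + lie (T p s) u = 0].

Lemma good_tri u : adcomm u -> tri p q r u -> tri p q s u -> tri p r s u ->
  tri q r s u -> good u.
Proof.
rewrite /tri (T_sym r p) (T_sym s p) (T_sym s q) => hu.
set x := lie (T p q) u; set y := lie (T p r) u; set z := lie (T p s) u.
set x' := lie (T r s) u; set y' := lie (T q s) u; set z' := lie (T q r) u.
move=> f1 f2 f3 f4.
(* The first two equations sum to [2a + (b + c + d + e) = 0], the last two to the same with [f] for
   [a]. *)
have opp_edges (a b c d e f : L) : a + b + c = 0 -> a + d + e = 0 -> c + f + e = 0 ->
    b + f + d = 0 -> a = f.
  move=> e1 e2 e3 e4.
  have hb : b = - (a + c) by apply/eqP; rewrite -addr_eq0 addrCA addrA e1.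
  have hd : d = - (a + e) by apply/eqP; rewrite -addr_eq0 addrCA addrA e2.
  have hf : c + e = - f by apply/eqP; rewrite -addr_eq0 addrAC e3.
  move/eqP: e4; rewrite hb hd addrAC -opprD addrACA hf addrC subr_eq0.
  rewrite eq_sym subr_eq -!mulr2n -!scaler_nat -subr_eq0 -scalerBr scaler_eq0.
  by rewrite pnatr_eq0 subr_eq0 => /eqP.
have ex : x = x' by exact: opp_edges f1 f2 f3 f4.
have ey : y = y'.
  apply: (@opp_edges y z' x x' z y') => //; last by rewrite addrAC.
  by rewrite addrC addrA addrAC.
have ez : z = z'.
  apply: (@opp_edges z y' x x' y z') => //; first by rewrite addrC addrA addrAC.
    by rewrite addrC addrA addrAC.
  by rewrite -addrA addrC.
split=> //.
by rewrite -/x -/y -/z ez addrAC.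
Qed.

Lemma tw_swap i j k : uniq [:: i; j; k] -> tw i k j = - tw i j k.
Proof. by move=> u; rewrite tw_rot; [exact: tw_rev | uniq_by u]. Qed.

(** By [lie_tw], [u] is up to sign an edge applied to any one of the four faces, and each face is
    killed by its own triangle sum. *)
Lemma tri_edge i j k l (u := lie (T i l) (tw i j k)) : uniq [:: i; j; k; l] ->
  [/\ tri i j k u, tri i j l u, tri i k l u & tri j k l u].
Proof.
move=> U; have hD m n o : adcomm (tw m n o) by exact: adcomm_lie.
have tl m n o v : uniq [:: m; n; o] -> tri m n o (lie v (tw m n o)).
  by move=> mno; apply: tri_lie => //; exact: tri_tw.
split.
- by apply: tl; uniq_by U.
- by rewrite /u lie_tw //; apply/triN/tl; uniq_by U.
- have -> : u = lie (T k j) (tw i k l).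
    rewrite /u (@tw_swap i k j); last by uniq_by U.
    by rewrite liexN lie_tw ?opprK //; uniq_by U.
  by apply: tl; uniq_by U.
- rewrite /u lie_tw // [tw i j l](_ : _ = tw j l i); last by apply: tw_rot; uniq_by U.
  rewrite [lie _ _](@lie_tw j l i k); last by uniq_by U.
  rewrite opprK tw_swap; last by uniq_by U.
  by rewrite liexN; apply/triN/tl; uniq_by U.
Qed.

Lemma w123_rot : w123 = tw q r p /\ w123 = tw r p q.
Proof.
have e : tw p q r = tw q r p by apply: tw_rot; uniq_by upqrs.
by split=> //; rewrite /w123 e; apply: tw_rot; uniq_by upqrs.
Qed.

Lemma good_u1 : good u1.
Proof.
have [t1 t2 t3 t4] := tri_edge upqrs.
by apply: good_tri => //; exact: adcomm_lie.
Qed.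

Lemma good_u2 : good u2.
Proof.
have U : uniq [:: q; r; p; s] by uniq_by upqrs.
rewrite /u2 (proj1 w123_rot); have [t1 t2 t3 t4] := tri_edge U.
apply: good_tri t2; first exact: adcomm_lie.
- exact/tri_rot/tri_rot.
- exact/tri_rot/tri_rev.
- exact/tri_rot/tri_rev.
Qed.

Lemma good_u3 : good u3.
Proof.
have U : uniq [:: r; p; q; s] by uniq_by upqrs.
rewrite /u3 (proj2 w123_rot); have [t1 t2 t3 t4] := tri_edge U.
apply: good_tri t4 _ _; first exact: adcomm_lie.
- exact/tri_rot.
- exact/tri_rot/tri_rev.
- exact/tri_rot/tri_rev.
Qed.

Lemma tw_flip i j k : uniq [:: i; j; k] -> tw j i k = - tw i j k.
Proof. by move=> u; rewrite tw_rot; [apply: tw_swap | uniq_by u]. Qed.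

(** This and the following [edge_] lemmas express an edge acting on a face that does not contain it
    through [u1], [u2], [u3]. *)
Lemma edge_qr_w124 : lie (T q r) w124 = - u1.
Proof. by rewrite /u1 lie_tw // opprK. Qed.

Lemma edge_pr_w124 : lie (T p r) w124 = - u2.
Proof.
have U : uniq [:: q; p; r; s] by uniq_by upqrs.
have := lie_tw U; rewrite (@tw_flip p q r); last by uniq_by upqrs.
rewrite (@tw_flip p q s); last by uniq_by upqrs.
by rewrite !liexN opprK => <-.
Qed.

Lemma edge_pq_w134 : lie (T p q) w134 = u3.
Proof.
have U : uniq [:: r; p; q; s] by uniq_by upqrs.
have := lie_tw U; rewrite -(proj2 w123_rot) (@tw_flip p r s); last by uniq_by upqrs.
by rewrite liexN opprK => <-.
Qed.

Lemma tw_s : tw s p q = w124 /\ tw s p r = w134.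
Proof. by split; apply: tw_rot; uniq_by upqrs. Qed.

Lemma edge_rs_w124 : lie (T r s) w124 = - u3.
Proof.
have U : uniq [:: s; p; q; r] by uniq_by upqrs.
by have := lie_tw U; rewrite (proj1 tw_s) (proj2 tw_s) edge_pq_w134 (T_sym s r).
Qed.

Lemma edge_qs_w134 : lie (T q s) w134 = u2.
Proof.
have U : uniq [:: s; p; r; q] by uniq_by upqrs.
by have := lie_tw U; rewrite (proj1 tw_s) (proj2 tw_s) edge_pr_w124 (T_sym s q) opprK.
Qed.

Lemma edge_qr_w134 : lie (T q r) w134 = u1.
Proof.
have U : uniq [:: p; r; q; s] by uniq_by upqrs.
have := lie_tw U; rewrite (@tw_swap p q r); last by uniq_by upqrs.
by rewrite liexN => /oppr_inj; rewrite (T_sym r q) => <-.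
Qed.

Lemma edge_pr_w234 : lie (T p r) w234 = - u2.
Proof.
have U : uniq [:: q; r; p; s] by uniq_by upqrs.
by have := lie_tw U; rewrite -(proj1 w123_rot) (T_sym r p) -/u2 => ->; rewrite opprK.
Qed.

Lemma goodD u v : good u -> good v -> good (u + v).
Proof.
case=> a1 a2 a3 a4 a5 [b1 b2 b3 b4 b5]; split; rewrite ?lieDr.
- exact: adcommD.
- by rewrite a2 b2.
- by rewrite a3 b3.
- by rewrite a4 b4.
- by rewrite (addrACA (lie (T p q) u)) (addrACA (lie (T p q) u + lie (T p r) u)) a5 b5 addr0.
Qed.

Lemma goodN u : good u -> good (- u).
Proof.
case=> a1 a2 a3 a4 a5; split; rewrite ?liexN ?a2 ?a3 ?a4 //.
- exact: adcommN.
- by rewrite -a2 -a3 -a4 -!opprD a5 oppr0.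
Qed.

Lemma good0 : good 0.
Proof.
split; rewrite ?liex0 ?addr0 // => u v; by rewrite !liex0.
Qed.

Lemma good_lie v u : good u -> good (lie v u).
Proof.
case=> a1 a2 a3 a4 a5; split; first exact: adcomm_lie.
- by rewrite a1 a2 a1.
- by rewrite a1 a3 a1.
- by rewrite a1 a4 a1.
- by rewrite !(a1 _ v) -!lieDr a5 liex0.
Qed.

Lemma good_iter k v u : good u -> good (iter k (lie v) u).
Proof. by move=> hu; elim: k => //= k; exact: good_lie. Qed.

Lemma good_adcomm u : good u -> adcomm u.
Proof. by case. Qed.

Lemma iter_good k x x' u : (forall v, good v -> lie x v = lie x' v) -> good u ->
  iter k (lie x) u = iter k (lie x') u.
Proof.
by move=> e hu; elim: k => //= k <-; apply/e/good_iter.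
Qed.

Lemma good_pq u : good u -> lie (T p q) u = lie (T r s) u. Proof. by case. Qed.
Lemma good_pr u : good u -> lie (T p r) u = lie (T q s) u. Proof. by case. Qed.

(* [Rr], [Sr] and [Er] measure how far words in sums of edges are from the sum of
   the words in which each face only sees its own edges. *)
Let Rr l := iter l (lie (T q r + T q s)) (w123 + w124)
  - iter l (lie (T q r)) w123 - iter l (lie (T q s)) w124.
Let Sr k := iter k (lie (T p r + T q r)) (w134 + w234)
  - iter k (lie (T p r)) w134 - iter k (lie (T q r)) w234.

(** The words [W], [A], [B], [W'] of the four single faces each occur on both sides of the pentagon
    and cancel, leaving the three defects. *)
Let pentagon_cancel (A B E W W' Y Z : L) :
  W' + (E + W) - (Y + Z) = E - A - B + (- (Y - W - A) - (Z - B - W')).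
Proof.
have c1 (P Q : L) : E - A - B + (P + A + (Q + B)) = E + (P + Q).
  by rewrite [P + A + _]addrACA -(addrA E) -opprD [P + Q + _]addrC addrA subrK.
rewrite !opprD !opprK [- Z + B + W']addrAC c1 [W' + _]addrC -!addrA.
congr (E + _); rewrite [RHS]addrCA; congr (W + _).
by rewrite addrC -addrA.
Qed.

(** Source of the recursions for the defects: lengthening a word by one edge sum creates exactly the
    two cross terms, where an edge meets the other face. *)
Lemma lie_split (x y A B C : L) :
  lie (x + y) A - lie x B - lie y C =
  lie (x + y) (A - B - C) + lie y B + lie x C.
Proof.
rewrite !lieBr [lie (x + y) B]lieDl [lie (x + y) C]lieDl.
move: (lie (x + y) A) (lie x B) (lie y B) (lie x C) (lie y C) => a b b' c c'.
by rewrite [X in X + c]addrAC opprD addrA subrK (opprD c) [- c - c']addrC addrA subrK.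
Qed.

Let subDD (x y : L) : x + y - x - y = 0.
Proof. by rewrite addrAC addrK subrr. Qed.

Ltac ac := repeat first [exact: good_adcomm | apply: adcommD | apply: adcomm_iter
  | exact: adcomm_lie].

Let Rr_S l : Rr l.+1 = lie (T q r + T q s) (Rr l)
  + (iter l (lie (T q r)) u2 - iter l (lie (T q s)) u1).
Proof.
rewrite /Rr !iterS lie_split -addrA; congr (_ + (_ + _)).
  by rewrite lie_iterC //; exact: adcomm_lie.
by rewrite lie_iterC ?edge_qr_w124 ?iter_lieN //; exact: adcomm_lie.
Qed.

Let Sr_S k : Sr k.+1 = lie (T p r + T q r) (Sr k)
  + (iter k (lie (T p r)) u1 - iter k (lie (T q r)) u2).
Proof.
rewrite /Sr !iterS lie_split -addrA; congr (_ + (_ + _)).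
  by rewrite lie_iterC ?edge_qr_w134 //; exact: adcomm_lie.
by rewrite lie_iterC ?edge_pr_w234 ?iter_lieN //; exact: adcomm_lie.
Qed.

Let good_Rr l : good (Rr l).
Proof.
elim: l => [|l IH]; first by rewrite /Rr /= subDD; exact: good0.
rewrite Rr_S; apply: goodD; first exact: good_lie.
by apply: goodD; [|apply: goodN]; apply: good_iter; [exact: good_u2 | exact: good_u1].
Qed.

(** [T p r] and [T q s] agree on good elements, so [Sr] and [- Rr] obey the same recursion from the
    same start 0. *)
Let SrE k : Sr k = - Rr k.
Proof.
elim: k => [|k IH].
  by rewrite /Sr /Rr /= !subDD oppr0.
rewrite Sr_S Rr_S IH liexN opprD opprB; congr (- _ + (_ - _)).
  by rewrite !lieDl (good_pr (good_Rr k)) addrC.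
by apply: iter_good good_u1; exact: good_pr.
Qed.

Let wd k l (x y : L) := iter k (lie x) (iter l (lie y) (lie x y)).

Let Er k l := iter k (lie (T p q + T p r)) (iter l (lie (T q s + T r s)) (w124 + w134))
  - iter k (lie (T p q)) (iter l (lie (T q s)) w124)
  - iter k (lie (T p r)) (iter l (lie (T r s)) w134).

Let hw i j k : adcomm (tw i j k). Proof. exact: adcomm_lie. Qed.

Let Er_Sl k l : Er k.+1 l = lie (T p q + T p r) (Er k l)
  + (iter k (lie (T p r)) (iter l (lie (T r s)) u3)
     - iter k (lie (T p q)) (iter l (lie (T q s)) u2)).
Proof.
rewrite /Er !iterS lie_split -addrA [X in _ = _ + X]addrC; congr (_ + (_ + _)).
  rewrite !lie_iterC ?edge_pr_w124 ?iter_lieN //; ac.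
by rewrite !lie_iterC ?edge_pq_w134 //; ac.
Qed.

Let Er_Sr k l : Er k l.+1 = lie (T q s + T r s) (Er k l)
  + (iter k (lie (T p r)) (iter l (lie (T r s)) u2)
     - iter k (lie (T p q)) (iter l (lie (T q s)) u3)).
Proof.
have hD : adcomm (w124 + w134) by ac.
have iter_lieS (A B z : L) : adcomm z ->
    iter k (lie A) (iter l.+1 (lie B) z) = lie B (iter k (lie A) (iter l (lie B) z)).
  by move=> hz; rewrite [RHS]lie_iterC; last by ac.
rewrite /Er !iter_lieS; try by ac.
rewrite lie_split -addrA [X in _ = _ + X]addrC; congr (_ + (_ + _)).
  rewrite !lie_iterC ?edge_rs_w124 ?iter_lieN //; ac.
by rewrite !lie_iterC ?edge_qs_w134 //; ac.
Qed.

Let good_Er k l : good (Er k l).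
Proof.
have g (x y : L) m n u : good u -> good (iter m (lie x) (iter n (lie y) u)).
  by move=> hu; do 2!apply: good_iter.
elim: k => [|k IH]; last first.
  rewrite Er_Sl; apply: goodD; first exact: good_lie.
  by apply: goodD; [|apply: goodN]; apply: g; [exact: good_u3 | exact: good_u2].
elim: l => [|l IH]; first by rewrite /Er /= subDD; exact: good0.
rewrite Er_Sr; apply: goodD; first exact: good_lie.
by apply: goodD; [|apply: goodN]; apply: g; [exact: good_u2 | exact: good_u3].
Qed.

(** In the symmetrization [F] the inhomogeneous terms of [Er_Sl] and [Er_Sr] cancel once opposite
    edges are identified. Thus [F] obeys a homogeneous recursion and vanishes at the origin. *)
Let Er_anti k l : Er k l = - Er l k.
Proof.
pose F k l := Er k l + Er l k.
have F_S m n : F m.+1 n = lie (T p q + T p r) (F m n).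
  have e3 : iter m (lie (T p r)) (iter n (lie (T r s)) u3) =
      iter n (lie (T p q)) (iter m (lie (T q s)) u3).
    rewrite iter_iterC ?(iter_good _ good_pr good_u3); last exact: good_adcomm good_u3.
    apply/esym/iter_good; [exact: good_pq | apply: good_iter; exact: good_u3].
  have e2 : iter m (lie (T p q)) (iter n (lie (T q s)) u2) =
      iter n (lie (T p r)) (iter m (lie (T r s)) u2).
    rewrite -(iter_good n good_pr good_u2) iter_iterC; last exact: good_adcomm good_u2.
    by congr iter; apply: iter_good; [exact: good_pq | exact: good_u2].
  rewrite /F Er_Sl Er_Sr e3 e2 [RHS]lieDr addrACA [X in _ + X](_ : _ = 0).
    rewrite addr0; congr (_ + _); have g := good_Er n m.
    by rewrite !lieDl (good_pq g) (good_pr g) addrC.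
  by rewrite addrC addrA subrK subrr.
have F_C m n : F m n = F n m by rewrite /F addrC.
have F_0 n : F n 0%N = 0.
  elim: n => [|n IH]; last by rewrite F_S IH liex0.
  by rewrite /F /Er /= subDD addr0.
have F_z m n : F m n = 0.
  elim: m => [|m IH]; first by rewrite F_C.
  by rewrite F_S IH liex0.
by apply/eqP; rewrite -addr_eq0; apply/eqP; exact: F_z.
Qed.

Lemma pentagon_words (alpha : nat -> nat -> K) m :
  (forall k l, alpha k l = alpha l k) ->
  let ph x y := \sum_(k < m.+1) alpha k (m - k)%N *: wd k (m - k) x y in
  ph (T q r) (T r s) + (ph (T p q + T p r) (T q s + T r s) + ph (T p q) (T q r)) =
  ph (T p q) (T q r + T q s) + ph (T p r + T q r) (T r s).
Proof.
move=> sym ph.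
have c0 : lie (T p q) (T r s) = 0 by exact: T_comm.
have c1 : lie (T p r) (T q s) = 0 by apply: T_comm; uniq_by upqrs.
(* For each pair of exponents the failure of the pentagon is an expression antisymmetric in [k] and
   [l]. *)
have wE k l : wd k l (T q r) (T r s) + (wd k l (T p q + T p r) (T q s + T r s)
    + wd k l (T p q) (T q r)) - (wd k l (T p q) (T q r + T q s)
    + wd k l (T p r + T q r) (T r s)) =
    Er k l + (- iter k (lie (T p q)) (Rr l) + iter l (lie (T p q)) (Rr k)).
  rewrite /wd.
  have -> : lie (T p q + T p r) (T q s + T r s) = w124 + w134.
    by rewrite !lieDl !lieDr c0 c1 addr0 add0r.
  have -> : lie (T p q) (T q r + T q s) = w123 + w124 by rewrite lieDr.
  have -> : lie (T p r + T q r) (T r s) = w134 + w234 by rewrite lieDl.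
  (* Opposite edges [pq] and [rs] agree on the good element [Rr k], which brings in the defect of
     the last word. *)
  have -> : iter l (lie (T p q)) (Rr k) = - iter l (lie (T r s)) (Sr k).
    by rewrite SrE iter_lieN opprK; apply: iter_good => //; exact: good_pq.
  rewrite [iter k (lie (T p r + _)) _]iter_iterC; last by ac.
  rewrite /Rr /Sr /Er !iter_lieB.
  rewrite [iter l (lie (T r s)) (iter k (lie (T p r)) w134)]iter_iterC; last by ac.
  rewrite [iter l (lie (T r s)) (iter k (lie (T q r)) w234)]iter_iterC; last by ac.
  exact: pentagon_cancel.
apply/eqP; rewrite -subr_eq0 /ph -!big_split -sumrB /=; apply/eqP.
under eq_bigr do rewrite -!scalerDr -scalerBr wE.
apply: (@antisym_sum0 _ _ alpha
  (fun k l => Er k l + (- iter k (lie (T p q)) (Rr l) + iter l (lie (T p q)) (Rr k)))) => //.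
by move=> k l; rewrite /= Er_anti !opprD; congr (_ + _); rewrite opprK addrC.
Qed.

End Tetrahedron.

(** * The pentagon in the four-strand algebra *)

Section Pentagon.
Variable K : numFieldType.

(** Made total, with value 0 on the diagonal, so that the chords form a function of two indices as
    [Tetrahedron] expects. *)
Definition edge n (i j : 'I_n) : Lbarhat K n :=
  match @idP (i != j) with ReflectT h => that K h | ReflectF _ => 0 end.

Lemma edgeE n (i j : 'I_n) (h : i != j) : edge i j = that K h.
Proof.
by rewrite /edge; case: {-}_ / idP => // h'; rewrite (bool_irrelevance h' h).
Qed.

Lemma edge_sym n (i j : 'I_n) : edge i j = edge j i.
Proof.
have [->|h] := eqVneq i j; first by [].
have h' : j != i by rewrite eq_sym.
by rewrite (edgeE h) (edgeE h') (that_sym K h h').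
Qed.

Lemma edge_comm n (i j k l : 'I_n) : uniq [:: i; j; k; l] ->
  lie (edge i j) (edge k l) = 0.
Proof.
move=> u; case/uniq4P: (u) => [[/eqP ij _ _] [_ _ /eqP kl]].
by rewrite (edgeE ij) (edgeE kl) that_comm.
Qed.

Lemma edge_4T n (i j k : 'I_n) : uniq [:: i; j; k] ->
  lie (edge i j) (edge j k) = lie (edge j k) (edge k i).
Proof.
case/uniq3P => /eqP ij /eqP; rewrite eq_sym => ki /eqP jk.
by rewrite (edgeE ij) (edgeE jk) (edgeE ki); exact: that_4T.
Qed.

Lemma phi_partE (L : lieAlgType K) (G : set L) alpha (x y : completion G) m :
  phi_part alpha x y m =
  \sum_(k < m.+1) alpha k (m - k)%N *: iter k (lie x) (iter (m - k) (lie y) (lie x y)).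
Proof. by apply: eq_bigr => k _; rewrite br_wordE. Qed.

Section Phibar.
Variables (L : lieAlgType K) (G : set L).
Hypothesis metabL : metabelian L.
Implicit Types x y z : completion G.

Lemma lie_phibar_comp (c : L) alpha x y d : (forall u v, lie c (lie u v) = 0) ->
  lie c (hcomp (phibar alpha x y) d) = 0.
Proof.
move=> hc; rewrite /= lie_sumr big1 // => m _; rewrite phi_partE hcomp_sum.
rewrite lie_sumr big1 // => k _; set b := iter _ _ _.
have [u [v ->]] : exists u v, b = lie u v.
  rewrite /b; case: (nat_of_ord k) => [|k']; last by do 2!eexists.
  by case: (m - 0)%N => [|l]; do 2!eexists.
rewrite -[hcomp _ d]/(_ *: hcomp (lie u v) d) lieZr hcomp_lie lie_sumr big1 ?scaler0 //.
Qed.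

Lemma lie_phibar alpha beta x y z t : lie (phibar alpha x y) (phibar beta z t) = 0.
Proof.
apply: hcomp_inj => d; rewrite hcomp_lie big1 // => i _.
by apply: lie_phibar_comp => u v; rewrite lie_anti lie_phibar_comp ?oppr0.
Qed.

End Phibar.

Lemma compressed_pentagon_holds (alpha : nat -> nat -> K) :
  (forall k l, alpha k l = alpha l k) -> compressed_pentagon alpha.
Proof.
move=> sym; rewrite /compressed_pentagon.
rewrite -!(@edgeE 4).
set p := @Ordinal 4 0 isT; set q := @Ordinal 4 1 isT.
set r := @Ordinal 4 2 isT; set s := @Ordinal 4 3 isT.
have M := @metab_Lbar K 4.
rewrite /log_prod_exp /=.
rewrite ![cbh _ 0]cbh_comm ?liex0 // !addr0.
rewrite [cbh (phibar _ _ _) (phibar _ (edge p q) (edge q r))]cbh_comm ?lie_phibar //.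
rewrite cbh_comm; last by rewrite lieDr !lie_phibar ?addr0.
rewrite cbh_comm ?lie_phibar //.
(* Both sides are now plain sums of [phibar] terms, and they agree separately for each
   [m = k + l]. *)
rewrite -!csumD; apply: eq_csum => m; rewrite !phi_partE.
apply: (@pentagon_words K _ (metab_hat M) 'I_4 (@edge 4)) => //.
- exact: edge_sym.
- exact: edge_comm.
- exact: edge_4T.
Qed.

End Pentagon.

Theorem theorem1 (R : realType) (alpha : nat -> nat -> R[i])
    (alpha_sym : forall k l : nat, alpha k l = alpha l k) :
  let f : fps2 R[i] := Fps2 alpha in
  (compressed_hexagon alpha <->
   f + fps_exp mu * fps_subst f mu (- lam - mu)
     + fps_exp (- lam) * fps_subst f lam (- lam - mu)
   = fps_div (fps_div (fps_exp mu - 1) mu + fps_div (fps_exp (- lam) - 1) lam)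
             (lam + mu))
  /\ compressed_pentagon alpha.
Proof.
by move=> f; split; [exact: hexagon_iff | exact: compressed_pentagon_holds].
Qed.
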